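(* Assume that the support projection $\hat\rho_1^0$ of $\hat\rho_1$ belongs to $\mathcal A_1$ (i.e. $\operatorname{supp}\rho_1$ is $G$-invariant) and that $\operatorname{supp}\rho_0\le\operatorname{supp}\rho_1$. Then for every $\varepsilon\in(0,1)$, $$-\psi'_+(1)\le\underline s_{G,\varepsilon}(\rho_0\,\|\,\rho_1)\le\overline s_{G,\varepsilon}(\rho_0\,\|\,\rho_1)\le-\psi'_-(1),$$ where $\psi'_+(1)$ and $\psi'_-(1)$ denote the right and left derivatives of $\psi$ at $1$.
   Context: Let $\mathcal H$ be a finite-dimensional complex Hilbert space, $G$ a compact group and $g\mapsto u_g$ a continuous unitary representation of $G$ on $\mathcal H$. For $n\in\mathbb N$ let $\mathcal A_n=\{A\in\mathcal B(\mathcal H^{\otimes n}):Au_g^{\otimes n}=u_g^{\otimes n}A\ \forall g\in G\}$ and $E_{\mathcal A_n}(X)=\int_G u_g^{\otimes n}Xu_g^{*\otimes n}\,dg$ (normalized Haar measure). Let $\rho_0,\rho_1$ be states on $\mathcal B(\mathcal H)$ with density matrices $\hat\rho_0,\hat\rho_1$, and $\hat\rho_{k,n}:=E_{\mathcal A_n}(\hat\rho_k^{\otimes n})$, $k=0,1$. Powers of positive semidefinite operators use the convention $0^s=0$ for all real $s$. Let $\psi_n(s)=\log\operatorname{Tr}\hat\rho_{0,n}^s\hat\rho_{1,n}^{1-s}$ and $\psi(s)=\lim_n\frac1n\psi_n(s)$; under the hypotheses of the claim this limit exists and is finite for all $s\in[0,2]$, and $\psi$ is convex there. For $T_n\in\mathcal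 A_n$, $0\le T_n\le I$, put $\beta_{0,n}(T_n)=\operatorname{Tr}\hat\rho_0^{\otimes n}(I-T_n)$, $\beta_{1,n}(T_n)=\operatorname{Tr}\hat\rho_1^{\otimes n}T_n$. For $\varepsilon\in(0,1)$, $\underline s_{G,\varepsilon}(\rho_0\|\rho_1)$ (resp. $\overline s_{G,\varepsilon}(\rho_0\|\rho_1)$) is the infimum of $\liminf_n\frac1n\log\beta_{1,n}(T_n)$ (resp. $\limsup_n\frac1n\log\beta_{1,n}(T_n)$) over all sequences $T_n\in\mathcal A_n$, $0\le T_n\le I$, with $\beta_{0,n}(T_n)\le\varepsilon$ for all $n$. *)

(* Defs.v *)
From HB Require Import structures.
From mathcomp Require Import all_boot all_order all_algebra.
From mathcomp Require Import all_classical all_reals all_analysis.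
From mathcomp Require Import complex mxtens sesquilinear spectral.
Set Implicit Arguments.
Unset Strict Implicit.
Unset Printing Implicit Defensive.
Import Order.TTheory GRing.Theory Num.Theory numFieldNormedType.Exports.
Local Open Scope ring_scope.
Local Open Scope classical_set_scope.

Section QHT.
Variable R : realType.
Local Notation C := (R[i]).

(** Adjoint (conjugate transpose). *)
Definition adj m n (A : 'M[C]_(m, n)) : 'M[C]_(n, m) := (A ^t*)%sesqui.

(** Positive semidefinite (in the Loewner order of C: 0 <= z means z real, z >= 0). *)
Definition psdmx n (A : 'M[C]_n) : Prop :=
  adj A = A /\ forall v : 'rV[C]_n, 0 <= (v *m A *m adj v) 0 0.

(** Density matrix of a state. *)
Definition density n (A : 'M[C]_n) : Prop := psdmx A /\ \tr A = 1.

(** n-fold tensor (Kronecker) power, H^{(x) n} having dimension d ^ n. *)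
Fixpoint tpow d (n : nat) (A : 'M[C]_d) : 'M[C]_(d ^ n) :=
  match n with
  | 0 => castmx (esym (expn0 d), esym (expn0 d)) 1%:M
  | k.+1 => castmx (esym (expnSr d k), esym (expnSr d k)) (tpow k A *t A)
  end.

(** Real power of a positive semidefinite matrix via its spectral decomposition
    A = M^* diag(l) M, with the convention 0^s = 0 for every real s. *)
Definition rpow_eig (s : R) (z : C) : C :=
  if 0 < complex.Re z then real_complex R (powR (complex.Re z) s) else 0.

Definition mxrpow n (A : 'M[C]_n) (s : R) : 'M[C]_n :=
  adj (spectralmx A) *m diag_mx (map_mx (rpow_eig s) (spectral_diag A))
     *m spectralmx A.

(** Support projection A^0. *)
Definition supp_proj n (A : 'M[C]_n) : 'M[C]_n := mxrpow A 0.

(** Compact (Hausdorff) topological group structure on G. *)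
Definition is_compact_group (G : topologicalType) (mul : G -> G -> G)
    (inv : G -> G) (one : G) : Prop :=
  [/\ associative mul, left_id one mul, left_inverse one inv mul,
      continuous (fun p : G * G => mul p.1 p.2) & continuous inv] /\
  compact [set: G] /\ hausdorff_space G.

(** Integral w.r.t. the normalized (left) Haar measure, as a functional on
    continuous real functions: linear, positive, normalized, left invariant. *)
Definition is_haar_integral (G : topologicalType) (mul : G -> G -> G)
    (I : (G -> R) -> R) : Prop :=
  [/\ (forall f g : G -> R, continuous f -> continuous g ->
         I (fun x => f x + g x) = I f + I g),
      (forall (a : R) (f : G -> R), continuous f -> I (fun x => a * f x) = a * I f),
      (forall f : G -> R, continuous f -> (forall x, 0 <= f x) -> 0 <= I f),
      I (fun _ => 1) = 1 &
      (forall (f : G -> R) (h : G), continuous f -> I (fun x => f (mul h x)) = I f)].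

(** Continuous unitary representation g |-> u_g on H = C^d. *)
Definition is_unitary_rep (G : topologicalType) (mul : G -> G -> G) d
    (u : G -> 'M[C]_d) : Prop :=
  [/\ forall g h, u (mul g h) = u g *m u h,
      forall g, u g *m adj (u g) = 1%:M &
      forall i j, continuous (fun g => complex.Re (u g i j)) /\
                  continuous (fun g => complex.Im (u g i j))].

(** Membership in A_n = commutant of {u_g^{(x) n}}. *)
Definition in_An (G : Type) d (u : G -> 'M[C]_d) n (A : 'M[C]_(d ^ n)) : Prop :=
  forall g, A *m tpow n (u g) = tpow n (u g) *m A.

(** E_{A_n}(X) = \int_G u_g^{(x)n} X u_g^{*(x)n} dg, entrywise (real and
    imaginary parts). *)
Definition E_An (G : Type) (I : (G -> R) -> R) d (u : G -> 'M[C]_d) n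
    (X : 'M[C]_(d ^ n)) : 'M[C]_(d ^ n) :=
  let F g := tpow n (u g) *m X *m adj (tpow n (u g)) in
  \matrix_(i, j) Complex (I (fun g => complex.Re (F g i j)))
                         (I (fun g => complex.Im (F g i j))).

(** psi_n(s) = log Tr rho_{0,n}^s rho_{1,n}^{1-s}  (the trace is real >= 0). *)
Definition psi_n (G : Type) (I : (G -> R) -> R) d (u : G -> 'M[C]_d)
    (rho0 rho1 : 'M[C]_d) (n : nat) (s : R) : R :=
  ln (complex.Re (\tr (mxrpow (E_An I u (tpow n rho0)) s
                       *m mxrpow (E_An I u (tpow n rho1)) (1 - s)))).

(** psi(s) = lim_n psi_n(s)/n. *)
Definition psi (G : Type) (I : (G -> R) -> R) d (u : G -> 'M[C]_d)
    (rho0 rho1 : 'M[C]_d) (s : R) : R :=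
  limn (fun n => psi_n I u rho0 rho1 n s / n%:R).

(** One-sided derivatives at a point. *)
Definition right_deriv (f : R -> R) (x : R) : R :=
  lim ((fun t => (f (x + t) - f x) / t) @ 0^'+).
Definition left_deriv (f : R -> R) (x : R) : R :=
  lim ((fun t => (f (x + t) - f x) / t) @ 0^'-).

(** Error probabilities. *)
Definition beta0 d (rho0 : 'M[C]_d) n (T : 'M[C]_(d ^ n)) : R :=
  complex.Re (\tr (tpow n rho0 *m (1%:M - T))).
Definition beta1 d (rho1 : 'M[C]_d) n (T : 'M[C]_(d ^ n)) : R :=
  complex.Re (\tr (tpow n rho1 *m T)).

(** (1/n) log x in the extended reals, with log 0 = -oo. *)
Definition lograte (n : nat) (x : R) : \bar R :=
  if x <= 0 then -oo%E else (ln x / n%:R)%:E.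

(** Admissible test sequences: T_n in A_n, 0 <= T_n <= I, beta_{0,n} <= eps. *)
Definition admissible (G : Type) d (u : G -> 'M[C]_d) (rho0 : 'M[C]_d)
    (eps : R) : set (forall n, 'M[C]_(d ^ n)) :=
  [set T | forall n, [/\ in_An u (T n), psdmx (T n), psdmx (1%:M - T n)
                       & beta0 rho0 (T n) <= eps]].

Definition s_lower (G : Type) d (u : G -> 'M[C]_d) (rho0 rho1 : 'M[C]_d)
    (eps : R) : \bar R :=
  ereal_inf [set limn_einf (fun n => lograte n (beta1 rho1 (T n)))
            | T in admissible u rho0 eps].

Definition s_upper (G : Type) d (u : G -> 'M[C]_d) (rho0 rho1 : 'M[C]_d)
    (eps : R) : \bar R :=
  ereal_inf [set limn_esup (fun n => lograte n (beta1 rho1 (T n)))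
            | T in admissible u rho0 eps].

End QHT.

(* Main.v *)
(**
  Write [r_k,n] for the averaged states and [Q_n(s) = Tr r_0,n^s r_1,n^(1-s)].

  Iterating the midpoint (geometric mean) argument for operator inequalities gives both the
  Loewner-Heinz inequality and a concavity statement of Lieb type: for [0 < t < 1] the form
  [Tr X_0^t K X_1^(1-t) K^*] does not decrease when [X_0], [X_1] are replaced by their group
  averages, provided that [K] commutes with the group.  Averaging [r_k,n+m] over the second
  tensor factor yields [r_k,n (x) r_k,m], so [ln Q_n(s)] is subadditive for [0 < s < 1] and,
  after a Cauchy-Schwarz step, superadditive for [1 < s < 2].  The domination
  [rho_0 <= c rho_1] gives linear bounds, and Fekete's lemma yields the limit [psi].  Each
  [ln Q_n] is the logarithm of a sum of exponentials with nonnegative weights, so [psi] is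
  convex and has one-sided derivatives at [1], where it vanishes.

  For the lower bound, the same Cauchy-Schwarz step applied to a test [T] with success
  probability [p] and error [q] gives [p^2 y^(s-1) <= Q_n(s) (p + y q)] for all [y > 0], hence
  [liminf (ln q) / n >= - psi(s) / (s - 1)] for [s > 1].  For the upper bound, the projection
  onto the positive part of [r_0,n - e^(n l) r_1,n] satisfies Audenaert's inequality
  [beta_0 + e^(n l) beta_1 <= e^(n l (1-s)) Q_n(s)], whose right-hand side vanishes in the limit
  when [l < psi(s) / (s - 1)] and [s < 1].
*)
Require Import Defs.
From HB Require Import structures.
From mathcomp Require Import all_boot all_order all_algebra.
From mathcomp Require Import all_classical all_reals all_analysis.
From mathcomp Require Import complex mxtens sesquilinear spectral.
From mathcomp Require Import ring lra.
Set Implicit Arguments.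
Unset Strict Implicit.
Unset Printing Implicit Defensive.
Import Order.TTheory GRing.Theory Num.Theory numFieldNormedType.Exports.
Local Open Scope ring_scope.
Local Open Scope classical_set_scope.

(** [psi] and the one-sided derivatives are [lim]s, which carry information only once convergence is
    known; hence the need for [Q_n] to be exactly sub- or supermultiplicative. An averaged power is
    not a tensor power, because all factors are rotated by the same group element; an additional
    average over some of the factors breaks this link, so one monotonicity statement for one pair of
    matrices and one group average suffices. The obstacle in the midpoint argument is the convention
    [0^s = 0]: powers of a singular matrix jump at [s = 0] and have no inverse. The dominated family
    therefore keeps the true powers, for which only [A^0 <= 1] is needed, while the dominating
    family uses powers of [A + d], bounded below by [d]. The shift is removed at the end through
    [(l + d)^t <= l^t + d^t]. For [s > 1] the power [1 - s] is negative and operator monotonicity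
    says nothing directly; each statement there is brought back to exponents in [(0,1)] by a
    Cauchy-Schwarz or second-moment inequality. Only [0 < s < 2] is treated, since derivatives at
    [1] see [psi] only near [1]. *)

Section LinearAlgebra.
Variable R : realType.
Local Notation C := (R[i]).
Local Notation "x %:C" := (real_complex R x) : ring_scope.

Lemma adjE m n (A : 'M[C]_(m, n)) i j : adj A i j = conjc (A j i).
Proof. by rewrite /adj !mxE. Qed.

Lemma adjK m n (A : 'M[C]_(m, n)) : adj (adj A) = A.
Proof. by apply/matrixP => i j; rewrite !adjE conjcK. Qed.

Lemma adjM m n p (A : 'M[C]_(m, n)) (B : 'M[C]_(n, p)) :
  adj (A *m B) = adj B *m adj A.
Proof. by rewrite /adj trmx_mul map_mxM. Qed.

Lemma adjD m n (A B : 'M[C]_(m, n)) : adj (A + B) = adj A + adj B.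
Proof. by apply/matrixP => i j; rewrite /adj !mxE rmorphD. Qed.

Lemma adjN m n (A : 'M[C]_(m, n)) : adj (- A) = - adj A.
Proof. by apply/matrixP => i j; rewrite /adj !mxE rmorphN. Qed.

Lemma adjB m n (A B : 'M[C]_(m, n)) : adj (A - B) = adj A - adj B.
Proof. by rewrite adjD adjN. Qed.

Lemma adjZ m n (a : R) (A : 'M[C]_(m, n)) : adj (a%:C *: A) = a%:C *: adj A.
Proof.
apply/matrixP => i j; rewrite /adj !mxE rmorphM; congr (_ * _).
exact: conjc_real.
Qed.

Lemma adj1 n : adj (1%:M : 'M[C]_n) = 1%:M.
Proof. by rewrite /adj trmx1 map_mx1. Qed.

Lemma adj_trmx m n (A : 'M[C]_(m, n)) : adj A^T = (adj A)^T.
Proof. by apply/matrixP => i j; rewrite /adj !mxE. Qed.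

Lemma adj_tens m n p q (A : 'M[C]_(m, n)) (B : 'M[C]_(p, q)) :
  adj (A *t B) = adj A *t adj B.
Proof. by apply/matrixP => i j; rewrite /adj !mxE rmorphM. Qed.

(** Error probabilities and [psi_n] are defined as real parts of traces, so all trace inequalities
    are stated in [R]. Invariance under adjoints ([rtr_adj]) then does the work of knowing that a
    trace is real. *)
Definition rtr n (A : 'M[C]_n) : R := complex.Re (\tr A).

Lemma rtrD n (A B : 'M[C]_n) : rtr (A + B) = rtr A + rtr B.
Proof. by rewrite /rtr linearD /= raddfD. Qed.

Lemma rtrN n (A : 'M[C]_n) : rtr (- A) = - rtr A.
Proof. by rewrite /rtr raddfN /= raddfN. Qed.

Lemma rtrB n (A B : 'M[C]_n) : rtr (A - B) = rtr A - rtr B.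
Proof. by rewrite rtrD rtrN. Qed.

Lemma rtr0 n : rtr (0 : 'M[C]_n) = 0.
Proof. by rewrite /rtr linear0. Qed.

Lemma rtrZ n (a : R) (A : 'M[C]_n) : rtr (a%:C *: A) = a * rtr A.
Proof.
by rewrite /rtr linearZ /=; case: (\tr A) => x y /=; rewrite mul0r subr0.
Qed.

Lemma rtrC m n (A : 'M[C]_(m, n)) (B : 'M[C]_(n, m)) :
  rtr (A *m B) = rtr (B *m A).
Proof. by rewrite /rtr mxtrace_mulC. Qed.

Lemma rtr_adj n (A : 'M[C]_n) : rtr (adj A) = rtr A.
Proof.
rewrite /rtr /mxtrace !raddf_sum; apply: eq_bigr => i _.
by rewrite adjE; case: (A i i).
Qed.

Lemma rtr_gram m n (A : 'M[C]_(m, n)) : 0 <= rtr (A *m adj A).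
Proof.
rewrite /rtr /mxtrace raddf_sum; apply: sumr_ge0 => i _.
rewrite mxE raddf_sum; apply: sumr_ge0 => j _.
rewrite adjE; case: (A i j) => x y /=.
by rewrite mulrN opprK addr_ge0 // -expr2 sqr_ge0.
Qed.

Lemma rtr_gram0 m n (A : 'M[C]_(m, n)) : rtr (A *m adj A) <= 0 -> A = 0.
Proof.
have ge0 i j : 0 <= complex.Re (A i j * adj A j i).
  rewrite adjE; case: (A i j) => x y /=.
  by rewrite mulrN opprK addr_ge0 // -expr2 sqr_ge0.
have E : rtr (A *m adj A) = \sum_i \sum_j complex.Re (A i j * adj A j i).
  by rewrite /rtr /mxtrace raddf_sum; apply: eq_bigr => i _;
    rewrite mxE raddf_sum.
move=> h; have /eqP : rtr (A *m adj A) = 0.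
  by apply/eqP; rewrite eq_le h rtr_gram.
rewrite E psumr_eq0; last by move=> i _; apply: sumr_ge0.
move=> /allP h1; apply/matrixP => i j.
have := h1 i (mem_index_enum i); rewrite psumr_eq0 // => /allP h2.
have /eqP := h2 j (mem_index_enum j); rewrite adjE mxE.
case: (A i j) => x y /=; rewrite mulrN opprK -!expr2 => /eqP.
by rewrite paddr_eq0 ?sqr_ge0 // !sqrf_eq0 => /andP[/eqP -> /eqP ->].
Qed.

Lemma psdmx_herm n (A : 'M[C]_n) : psdmx A -> adj A = A.
Proof. by case. Qed.

(** The complex order also demands a vanishing imaginary part of the form; hermiticity supplies
    it. *)
Lemma psdmxI n (A : 'M[C]_n) : adj A = A ->
  (forall v : 'rV[C]_n, 0 <= rtr (v *m A *m adj v)) -> psdmx A.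
Proof.
move=> hA h; split => // v; have := h v; rewrite /rtr trace_mx11.
have: adj (v *m A *m adj v) = v *m A *m adj v.
  by rewrite !adjM adjK hA mulmxA.
move/matrixP => /(_ 0 0); rewrite adjE.
case: ((v *m A *m adj v) 0 0) => x y [] /= hy h0.
rewrite lecE /= h0 andbT; apply/eqP.
by move: hy => /eqP; rewrite eq_sym -addr_eq0 -mulr2n mulrn_eq0 => /eqP.
Qed.

Lemma psdmx_form n (A : 'M[C]_n) (v : 'rV[C]_n) : psdmx A ->
  0 <= rtr (v *m A *m adj v).
Proof. by move=> [_ /(_ v)]; rewrite /rtr trace_mx11 lecE => /andP[]. Qed.

Lemma psdmx_conj m n (A : 'M[C]_n) (X : 'M[C]_(m, n)) :
  psdmx A -> psdmx (X *m A *m adj X).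
Proof.
move=> pA; apply: psdmxI; first by rewrite !adjM adjK psdmx_herm // mulmxA.
by move=> v; have := psdmx_form (v *m X) pA; rewrite adjM !mulmxA.
Qed.

Lemma psdmx1 n : psdmx (1%:M : 'M[C]_n).
Proof.
by apply: psdmxI; [exact: adj1 | move=> v; rewrite mulmx1 rtr_gram].
Qed.

Lemma psdmx_gram m n (X : 'M[C]_(m, n)) : psdmx (X *m adj X).
Proof. by rewrite -[X in X *m _]mulmx1; apply/psdmx_conj/psdmx1. Qed.

Lemma psdmxD n (A B : 'M[C]_n) : psdmx A -> psdmx B -> psdmx (A + B).
Proof.
move=> pA pB; apply: psdmxI; first by rewrite adjD !psdmx_herm.
by move=> v; rewrite mulmxDr mulmxDl rtrD addr_ge0 // psdmx_form.
Qed.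

Lemma psdmxZ n (a : R) (A : 'M[C]_n) : 0 <= a -> psdmx A -> psdmx (a%:C *: A).
Proof.
move=> a0 pA; apply: psdmxI; first by rewrite adjZ psdmx_herm.
by move=> v; rewrite -scalemxAr -scalemxAl rtrZ mulr_ge0 // psdmx_form.
Qed.

Definition lemx n (A B : 'M[C]_n) : Prop := psdmx (B - A).

Lemma lemx_refl n (A : 'M[C]_n) : lemx A A.
Proof.
rewrite /lemx subrr; apply: psdmxI; first by rewrite -(subrr A) adjB !subrr.
by move=> v; rewrite mulmx0 mul0mx rtr0.
Qed.

Lemma psdmx_lemx n (A : 'M[C]_n) : psdmx A <-> lemx 0 A.
Proof. by rewrite /lemx subr0. Qed.

Lemma lemx_trans n (B A D : 'M[C]_n) : lemx A B -> lemx B D -> lemx A D.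
Proof. move=> h1 h2; rewrite /lemx; have := psdmxD h2 h1.
by congr psdmx; rewrite addrA; congr (_ - _); rewrite subrK. Qed.

Lemma lemx_psdmx n (A B : 'M[C]_n) : psdmx A -> lemx A B -> psdmx B.
Proof. by move=> /psdmx_lemx h1 h2; apply/psdmx_lemx; apply: lemx_trans h1 h2. Qed.

Lemma lemxD n (A B A' B' : 'M[C]_n) :
  lemx A B -> lemx A' B' -> lemx (A + A') (B + B').
Proof. move=> h1 h2; rewrite /lemx; have := psdmxD h1 h2.
by congr psdmx; rewrite opprD [LHS]addrACA. Qed.

Lemma lemxZ n (a : R) (A B : 'M[C]_n) :
  0 <= a -> lemx A B -> lemx (a%:C *: A) (a%:C *: B).
Proof. by move=> a0 h; rewrite /lemx -scalerBr; apply: psdmxZ. Qed.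

Lemma lemxZl n (a b : R) (A : 'M[C]_n) :
  a <= b -> psdmx A -> lemx (a%:C *: A) (b%:C *: A).
Proof.
by move=> ab pA; rewrite /lemx -scalerBl -raddfB; apply: psdmxZ; rewrite ?subr_ge0.
Qed.

Lemma lemx_conj m n (A B : 'M[C]_n) (X : 'M[C]_(m, n)) :
  lemx A B -> lemx (X *m A *m adj X) (X *m B *m adj X).
Proof. by move=> h; rewrite /lemx -mulmxBl -mulmxBr; apply: psdmx_conj. Qed.

Lemma lemx_form n (A B : 'M[C]_n) (v : 'rV[C]_n) : lemx A B ->
  rtr (v *m A *m adj v) <= rtr (v *m B *m adj v).
Proof. by move=> h; rewrite -subr_ge0 -rtrB -mulmxBl -mulmxBr psdmx_form. Qed.

Lemma lemxI n (A B : 'M[C]_n) : adj A = A -> adj B = B ->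
  (forall v : 'rV[C]_n, rtr (v *m A *m adj v) <= rtr (v *m B *m adj v)) ->
  lemx A B.
Proof.
move=> hA hB h; apply: psdmxI; first by rewrite adjB hA hB.
by move=> v; rewrite mulmxBr mulmxBl rtrB subr_ge0.
Qed.

(** * Functional calculus of Hermitian matrices *)

Definition dg n (l : 'I_n -> R) : 'M[C]_n := diag_mx (\row_i (l i)%:C).

Lemma mul_dgE m n (l : 'I_m -> R) (A : 'M[C]_(m, n)) i j :
  (dg l *m A) i j = (l i)%:C * A i j.
Proof. by rewrite mul_diag_mx !mxE. Qed.

Lemma mulr_dgE m n (l : 'I_n -> R) (A : 'M[C]_(m, n)) i j :
  (A *m dg l) i j = A i j * (l j)%:C.
Proof. by rewrite mul_mx_diag !mxE. Qed.

Lemma dgM n (l m : 'I_n -> R) : dg l *m dg m = dg (fun i => l i * m i).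
Proof.
by rewrite /dg mulmx_diag; congr diag_mx; apply/rowP => i; rewrite !mxE rmorphM.
Qed.

Lemma dgD n (l m : 'I_n -> R) : dg l + dg m = dg (fun i => l i + m i).
Proof.
by rewrite /dg -linearD; congr diag_mx; apply/rowP => i; rewrite !mxE rmorphD.
Qed.

Lemma dg1 n : dg (fun=> 1) = 1%:M :> 'M[C]_n.
Proof. by apply/matrixP => i j; rewrite !mxE rmorph1. Qed.

Lemma eq_dg n (l m : 'I_n -> R) : l =1 m -> dg l = dg m.
Proof. by move=> h; congr diag_mx; apply/rowP => i; rewrite !mxE h. Qed.

Lemma adj_dg n (l : 'I_n -> R) : adj (dg l) = dg l.
Proof.
apply/matrixP => i j; rewrite adjE !mxE eq_sym.
by case: eqP => [->|_]; rewrite ?mulr1n ?mulr0n ?rmorph0 //=; simpc.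
Qed.

Lemma dgZ n (a : R) (l : 'I_n -> R) : a%:C *: dg l = dg (fun i => a * l i).
Proof.
by rewrite /dg -linearZ; congr diag_mx; apply/rowP => i; rewrite !mxE rmorphM.
Qed.

Lemma rtr_dg n (l : 'I_n -> R) : rtr (dg l) = \sum_i l i.
Proof.
by rewrite /rtr /dg mxtrace_diag raddf_sum; apply: eq_bigr => i _; rewrite mxE.
Qed.

Lemma psdmx_dg n (l : 'I_n -> R) : (forall i, 0 <= l i) -> psdmx (dg l).
Proof.
pose m i := Num.sqrt (l i); move=> h.
rewrite (_ : dg l = dg m *m adj (dg m)).
  exact: psdmx_gram.
by rewrite adj_dg dgM; apply: eq_dg => i; rewrite -expr2 sqr_sqrtr.
Qed.

Lemma unitary_adjl n (U : 'M[C]_n) : U *m adj U = 1%:M -> adj U *m U = 1%:M.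
Proof. exact: mulmx1C. Qed.

Definition eig n (A : 'M[C]_n) (i : 'I_n) : R := complex.Re (spectral_diag A 0 i).

(** Real parts of the eigenvalues are used, so [fmx f A] is Hermitian for every [A]; only for
    Hermitian [A] does [fmx id A] return [A]. *)
Definition fmx n (f : R -> R) (A : 'M[C]_n) : 'M[C]_n :=
  adj (spectralmx A) *m dg (f \o eig A) *m spectralmx A.

Lemma spectral_unitary n (A : 'M[C]_n) : spectralmx A *m adj (spectralmx A) = 1%:M.
Proof. by apply/eqP; have := spectral_unitarymx A; rewrite qualifE. Qed.

Lemma spectral_unitaryl n (A : 'M[C]_n) : adj (spectralmx A) *m spectralmx A = 1%:M.
Proof. exact/unitary_adjl/spectral_unitary. Qed.

Lemma fmx_id n (A : 'M[C]_n) : adj A = A -> fmx id A = A.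
Proof.
move=> hA; have herm : A \is hermsymmx.
  by apply/is_hermitianmxP; rewrite expr0 scale1r -[LHS]hA.
have /orthomx_spectralP E := hermitian_normalmx herm.
rewrite (invmx_unitary (spectral_unitarymx A)) in E.
rewrite [RHS]E /fmx.
apply: (congr1 (fun D => adj (spectralmx A) *m D *m spectralmx A)).
rewrite /dg; congr diag_mx; apply/rowP => i.
have /mxOverP /(_ 0 i) h := hermitian_spectral_diag_real herm.
by rewrite mxE /= RRe_real.
Qed.

Lemma eq_fmx n (f g : R -> R) (A : 'M[C]_n) :
  (forall i, f (eig A i) = g (eig A i)) -> fmx f A = fmx g A.
Proof. by move=> h; rewrite /fmx (@eq_dg _ _ (g \o eig A)). Qed.

Lemma adj_fmx n (f : R -> R) (A : 'M[C]_n) : adj (fmx f A) = fmx f A.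
Proof. by rewrite /fmx !adjM adjK adj_dg mulmxA. Qed.

Lemma fmxM n (f g : R -> R) (A : 'M[C]_n) :
  fmx f A *m fmx g A = fmx (fun x => f x * g x) A.
Proof.
by rewrite /fmx !mulmxA -[_ *m _ *m adj _]mulmxA spectral_unitary mulmx1
  -[_ *m dg _ *m dg _]mulmxA dgM.
Qed.

Lemma fmxD n (f g : R -> R) (A : 'M[C]_n) :
  fmx f A + fmx g A = fmx (fun x => f x + g x) A.
Proof. by rewrite /fmx -mulmxDl -mulmxDr dgD. Qed.

Lemma fmxZ n (a : R) (f : R -> R) (A : 'M[C]_n) :
  a%:C *: fmx f A = fmx (fun x => a * f x) A.
Proof. by rewrite /fmx scalemxAl scalemxAr dgZ. Qed.

Lemma fmx1 n (A : 'M[C]_n) : fmx (fun=> 1) A = 1%:M.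
Proof. by rewrite /fmx (eq_dg (m := fun=> 1)) // dg1 mulmx1 spectral_unitaryl. Qed.

Lemma fmx_psd n (f : R -> R) (A : 'M[C]_n) :
  (forall i, 0 <= f (eig A i)) -> psdmx (fmx f A).
Proof.
by move=> h; rewrite /fmx -{2}[spectralmx A]adjK; apply/psdmx_conj/psdmx_dg.
Qed.

Lemma fmx_le n (f g : R -> R) (A : 'M[C]_n) :
  (forall i, f (eig A i) <= g (eig A i)) -> lemx (fmx f A) (fmx g A).
Proof.
move=> h; rewrite /lemx (_ : fmx g A - fmx f A = fmx (fun x => g x - f x) A).
  by apply: fmx_psd => i; rewrite subr_ge0.
by apply/eqP; rewrite subr_eq fmxD; apply/eqP/eq_fmx => i; rewrite subrK.
Qed.

Lemma eig_row n (A : 'M[C]_n) i : adj A = A ->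
  row i (spectralmx A) *m A = (eig A i)%:C *: row i (spectralmx A).
Proof.
move=> hA; rewrite -row_mul -[in X in row i (_ *m X)](fmx_id hA) /fmx !mulmxA.
rewrite spectral_unitary mul1mx; apply/rowP => j.
by rewrite mxE mul_dgE !mxE.
Qed.

Lemma row_spectral n (A : 'M[C]_n) i :
  rtr (row i (spectralmx A) *m adj (row i (spectralmx A))) = 1.
Proof.
have /matrixP /(_ i i) := spectral_unitary A; rewrite !mxE eqxx => h.
rewrite /rtr trace_mx11 mxE.
rewrite (_ : \sum_j _ = \sum_j spectralmx A i j * adj (spectralmx A) j i).
  by rewrite h.
by apply: eq_bigr => j _; rewrite !adjE !mxE.
Qed.

Lemma eig_ge0 n (A : 'M[C]_n) i : psdmx A -> 0 <= eig A i.
Proof.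
move=> pA; have := psdmx_form (row i (spectralmx A)) pA.
by rewrite eig_row ?psdmx_herm // -scalemxAl rtrZ row_spectral mulr1.
Qed.

(** Entrywise the hypothesis says [l i = k j] wherever [Y i j] is nonzero, and this persists after
    applying [f] to both diagonals. *)
Lemma dg_intertwine m n (l : 'I_m -> R) (k : 'I_n -> R) (Y : 'M[C]_(m, n)) f :
  dg l *m Y = Y *m dg k -> dg (f \o l) *m Y = Y *m dg (f \o k).
Proof.
move=> /matrixP h; apply/matrixP => i j; have := h i j.
rewrite !mul_dgE !mulr_dgE [Y i j * _]mulrC => /eqP.
rewrite -subr_eq0 -mulrBl mulf_eq0 -raddfB.
move=> /orP[/eqP/(congr1 (@complex.Re R)) /= /eqP|/eqP ->].
  by rewrite subr_eq0 => /eqP ->; rewrite mulrC.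
by rewrite mulr0 mul0r.
Qed.

Lemma diag_intertwine m n (U : 'M[C]_m) (V : 'M[C]_n) l k (X : 'M[C]_(m, n)) f :
  U *m adj U = 1%:M -> V *m adj V = 1%:M ->
  adj U *m dg l *m U *m X = X *m (adj V *m dg k *m V) ->
  adj U *m dg (f \o l) *m U *m X = X *m (adj V *m dg (f \o k) *m V).
Proof.
move=> hU hV h.
have {h} : dg l *m (U *m X *m adj V) = (U *m X *m adj V) *m dg k.
  have := congr1 (fun M => U *m M *m adj V) h.
  rewrite !mulmxA hU mul1mx => ->.
  by rewrite -[_ *m V *m adj V]mulmxA hV mulmx1.
move/(@dg_intertwine _ _ _ _ _ f)=> /(congr1 (fun M => adj U *m M *m V)).
rewrite !mulmxA (unitary_adjl hU) mul1mx => <-.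
by rewrite -[_ *m adj V *m V]mulmxA (unitary_adjl hV) mulmx1.
Qed.

Lemma fmx_intertwine m n (A : 'M[C]_m) (B : 'M[C]_n) (X : 'M[C]_(m, n)) f :
  adj A = A -> adj B = B -> A *m X = X *m B -> fmx f A *m X = X *m fmx f B.
Proof.
move=> hA hB h; apply: diag_intertwine; rewrite ?spectral_unitary //.
by have := h; rewrite -{1}(fmx_id hA) -{1}(fmx_id hB).
Qed.

(** Intertwining with the identity matrix shows that the functional calculus does not depend on the
    eigenbasis. This is what makes powers of scaled matrices and of tensor products computable. *)
Lemma fmx_diag n (V : 'M[C]_n) (l : 'I_n -> R) f :
  V *m adj V = 1%:M -> fmx f (adj V *m dg l *m V) = adj V *m dg (f \o l) *m V.
Proof.
move=> hV; have hA : adj (adj V *m dg l *m V) = adj V *m dg l *m V.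
  by rewrite !adjM adjK adj_dg mulmxA.
have := @diag_intertwine _ _ _ _ (id \o eig (adj V *m dg l *m V)) l 1%:M f
  (spectral_unitary (adj V *m dg l *m V)) hV.
by rewrite !mulmx1 !mul1mx; apply; apply: fmx_id.
Qed.

(** Reduces an operator bound to single eigenvectors, the form in which the midpoint step can be
    carried out. *)
Lemma eigenvalue_le n (A : 'M[C]_n) (k : R) : adj A = A ->
  (forall (l : R) (w : 'rV[C]_n), w != 0 -> w *m A = l%:C *: w -> l <= k) ->
  lemx A (k%:C%:M).
Proof.
move=> hA h; rewrite -[X in lemx X _](fmx_id hA) -scalemx1 -(fmx1 A) fmxZ.
apply: fmx_le => i; rewrite mulr1; apply: h (eig_row i hA).
apply/negP => /eqP h0; have := row_spectral A i.
by rewrite h0 mul0mx rtr0 => /eqP; rewrite eq_sym oner_eq0.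
Qed.

End LinearAlgebra.

(** * Elementary estimates for real powers *)

Section ScalarPowers.
Variable R : realType.

Lemma powRE (x a : R) : 0 < x -> x `^ a = expR (a * ln x).
Proof. by move=> x0; rewrite /powR gt_eqF. Qed.

Lemma powR_add (x a b : R) : 0 < x -> x `^ a * x `^ b = x `^ (a + b).
Proof. by move=> x0; rewrite !powRE // -expRD mulrDl. Qed.

(** The bound is uniform in [t], as is the lower bound of the next lemma: the midpoint iteration
    starts from one constant valid for all exponents. *)
Lemma powR_le_1D (x t : R) : 0 < x -> 0 <= t <= 1 -> x `^ t <= 1 + x.
Proof.
move=> x0 /andP[t0 t1]; rewrite powRE //.
have [h|h] := leP (ln x) 0.
  rewrite (@le_trans _ _ 1) ?lerDl ?(ltW x0) //.
  by rewrite -expR0 ler_expR mulr_ge0_le0.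
rewrite (@le_trans _ _ x) ?lerDr //.
by rewrite -{2}[x]lnK // ler_expR ler_piMl // ltW.
Qed.

Lemma le_powR_of_le (x d t : R) : 0 < d <= 1 -> d <= x -> 0 <= t <= 1 -> d <= x `^ t.
Proof.
move=> /andP[d0 d1] dx /andP[t0 t1]; have x0 : 0 < x := lt_le_trans d0 dx.
rewrite powRE //; have [h|h] := leP 0 (ln x).
  by rewrite (le_trans d1) // -expR0 ler_expR mulr_ge0.
rewrite (le_trans dx) // -{1}[x]lnK // ler_expR.
by rewrite -[leLHS]mul1r ler_wnM2r // ltW.
Qed.

Lemma exists_small_powR (t e : R) : 0 < t < 1 -> 0 < e < 1 ->
  exists d, [/\ 0 < d < 1, d `^ t <= e & d `^ (1 - t) <= e].
Proof.
move=> /andP[t0 t1] /andP[e0 e1].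
have u0 : 0 < 1 - t by rewrite subr_gt0.
have le0 : ln e < 0 by apply: ln_lt0; rewrite e0.
(* This is [e^(1/(t(1-t)))]: its powers [t] and [1 - t] are [e^(1/(1-t))] and [e^(1/t)], both at
   most [e] because [e < 1]. *)
exists (expR (ln e / (t * (1 - t)))); split.
- rewrite expR_gt0 -[ltRHS]expR0 ltr_expR.
  by rewrite pmulr_llt0 // invr_gt0 mulr_gt0.
- rewrite powRE ?expR_gt0 // expRK -{2}[e]lnK // ler_expR.
  rewrite (_ : t * _ = (1 - t)^-1 * ln e); last by field; lra.
  by rewrite -[leRHS]mul1r ler_wnM2r ?ltW // invf_gt1 //; lra.
- rewrite powRE ?expR_gt0 // expRK -{2}[e]lnK // ler_expR.
  rewrite (_ : (1 - t) * _ = t^-1 * ln e); last by field; lra.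
  by rewrite -[leRHS]mul1r ler_wnM2r ?ltW // invf_gt1 //; lra.
Qed.

(* Vanishes on nonpositive numbers, also for [s = 0], as in the definition of [mxrpow]. *)
Definition pw (s x : R) : R := if 0 < x then x `^ s else 0.

Lemma pw_ge0 s x : 0 <= pw s x.
Proof. by rewrite /pw; case: ifP => // _; apply: powR_ge0. Qed.

Lemma pwM s t x : pw s x * pw t x = pw (s + t) x.
Proof.
by rewrite /pw; case: ifP => h; [rewrite powR_add | rewrite mul0r].
Qed.

Lemma pw1 x : 0 <= x -> pw 1 x = x.
Proof. by rewrite /pw; case: ltgtP => // h _; apply: powRr1; apply: ltW. Qed.

(** Subadditivity of [x^t]: a share [v = x / (l + d)] with [v <= 1] satisfies [v <= v^t], and the
    shares of [l] and [d] add up to one. *)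
Lemma powR_shift_le (l d t : R) : 0 <= l -> 0 < d -> 0 < t < 1 ->
  (l + d) `^ t <= pw t l + d `^ t.
Proof.
move=> l0 d0 /andP[t0 t1]; rewrite /pw; case: ltgtP l0 => // [l0 _|<- _]; last first.
  by rewrite !add0r.
have s0 : 0 < l + d by rewrite addr_gt0.
have key x : 0 < x -> x <= l + d -> x / (l + d) * (l + d) `^ t <= x `^ t.
  move=> x0 xs; have u0 : 0 < x / (l + d) by rewrite divr_gt0.
  have : x / (l + d) <= (x / (l + d)) `^ t.
    apply: le_powR_of_le => //; last by rewrite !ltW.
    by rewrite u0 /= ler_pdivrMr // mul1r.
  move=> h; apply: (le_trans (ler_wpM2r (powR_ge0 _ _) h)).
  by rewrite -powRM ?(ltW u0) ?(ltW s0) // divfK ?gt_eqF.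
have -> : (l + d) `^ t = l / (l + d) * (l + d) `^ t + d / (l + d) * (l + d) `^ t.
  by rewrite -mulrDl -mulrDl divff ?gt_eqF // mul1r.
by apply: lerD; apply: key => //; rewrite ?lerDl ?lerDr ltW.
Qed.

Lemma le_of_half_powers (x y z : R) :
  (forall n, x <= y + z / 2 ^+ n) -> x <= y.
Proof.
move=> h; rewrite leNgt; apply/negP => yx.
have d0 : 0 < x - y by rewrite subr_gt0.
have [n hn] : exists n : nat, `|z| / (x - y) < n%:R.
  by exists (Num.bound (`|z| / (x - y))); apply/archi_boundP; rewrite divr_ge0 // ltW.
have p0 : 0 < 2 ^+ n :> R by rewrite exprn_gt0.
have := h n; rewrite -lerBlDl ler_pdivlMr //.
apply/negP; rewrite -ltNge; apply: (le_lt_trans (ler_norm z)).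
move: hn; rewrite ltr_pdivrMr // => /lt_le_trans; apply.
rewrite mulrC ler_wpM2l ?(ltW d0) //.
by rewrite -natrX ler_nat ltnW // ltn_expl.
Qed.

Lemma le_of_eps (x y z : R) : (forall e, 0 < e < 1 -> x <= y + e * z) -> x <= y.
Proof.
move=> h; apply: (@le_of_half_powers _ _ (z / 2)) => n.
have p0 : 0 < 2 ^+ n :> R by rewrite exprn_gt0.
have := h ((2 ^+ n.+1)^-1); rewrite exprS invfM mulrC => h1.
rewrite (_ : z / 2 / 2 ^+ n = 2^-1 / 2 ^+ n * z); last by field; rewrite gt_eqF.
have := h (2^-1 / 2 ^+ n); apply; apply/andP; split.
  by rewrite divr_gt0 ?invr_gt0.
rewrite -invfM invf_lt1 ?mulr_gt0 //.
rewrite -exprS -natrX ltr1n.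
by apply: (@leq_trans (2 ^ 1)) => //; rewrite leq_exp2l.
Qed.

End ScalarPowers.

(** * Powers of positive semidefinite matrices and the Loewner order *)

Section MatrixPowers.
Variable R : realType.
Local Notation C := (R[i]).
Local Notation "x %:C" := (real_complex R x) : ring_scope.

Lemma mxrpowE n (A : 'M[C]_n) s : mxrpow A s = fmx (pw s) A.
Proof.
rewrite /mxrpow /fmx /dg; congr (_ *m diag_mx _ *m _); apply/rowP => i.
by rewrite !mxE /rpow_eig /= /pw /eig; case: ifP.
Qed.

Lemma adj_mxrpow n (A : 'M[C]_n) s : adj (mxrpow A s) = mxrpow A s.
Proof. by rewrite mxrpowE adj_fmx. Qed.

Lemma psdmx_mxrpow n (A : 'M[C]_n) s : psdmx (mxrpow A s).
Proof. by rewrite mxrpowE; apply: fmx_psd => i; apply: pw_ge0. Qed.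

Lemma mxrpowD n (A : 'M[C]_n) s t : mxrpow A s *m mxrpow A t = mxrpow A (s + t).
Proof. by rewrite !mxrpowE fmxM; apply: eq_fmx => i; apply: pwM. Qed.

Lemma mxrpow1 n (A : 'M[C]_n) : psdmx A -> mxrpow A 1 = A.
Proof.
move=> pA; rewrite mxrpowE -[RHS](fmx_id (psdmx_herm pA)).
by apply: eq_fmx => i; rewrite pw1 // eig_ge0.
Qed.

(** Exhibits every power as the square of a Hermitian matrix; positivity of traces and of block
    forms is deduced from this. *)
Lemma mxrpow_sqrt n (A : 'M[C]_n) s : mxrpow A (s / 2) *m mxrpow A (s / 2) = mxrpow A s.
Proof. by rewrite mxrpowD -splitr. Qed.

Lemma mxrpow_suppl n (A : 'M[C]_n) : psdmx A -> mxrpow A 0 *m A = A.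
Proof. by move=> pA; rewrite -{2}(mxrpow1 pA) mxrpowD add0r mxrpow1. Qed.

Lemma supp_le1 n (A : 'M[C]_n) : lemx (mxrpow A 0) 1%:M.
Proof.
rewrite mxrpowE -(fmx1 A); apply: fmx_le => i.
by rewrite /pw; case: ifP; rewrite ?powRr0.
Qed.

Lemma rtr_psd_ge0 n (A : 'M[C]_n) : psdmx A -> 0 <= rtr A.
Proof.
move=> pA; rewrite -(mxrpow1 pA) -mxrpow_sqrt -{2}[mxrpow A _]adj_mxrpow.
exact: rtr_gram.
Qed.

Lemma rtr_mul_ge0 n (A B : 'M[C]_n) : psdmx A -> psdmx B -> 0 <= rtr (A *m B).
Proof.
move=> pA pB; rewrite -(mxrpow1 pA) -mxrpow_sqrt -mulmxA rtrC.
by rewrite -{2}[mxrpow A _]adj_mxrpow; apply/rtr_psd_ge0/psdmx_conj.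
Qed.

Lemma ler_rtrl n (A B D : 'M[C]_n) : lemx A B -> psdmx D ->
  rtr (A *m D) <= rtr (B *m D).
Proof. by move=> h pD; rewrite -subr_ge0 -rtrB -mulmxBl rtr_mul_ge0. Qed.

Lemma ler_rtrr n (A B D : 'M[C]_n) : lemx A B -> psdmx D ->
  rtr (D *m A) <= rtr (D *m B).
Proof. by move=> h pD; rewrite ![rtr (D *m _)]rtrC ler_rtrl. Qed.

Lemma ler_rtr n (A B : 'M[C]_n) : lemx A B -> rtr A <= rtr B.
Proof. by move=> h; rewrite -subr_ge0 -rtrB rtr_psd_ge0. Qed.

Lemma rtr_fmx n f (A : 'M[C]_n) : rtr (fmx f A) = \sum_i f (eig A i).
Proof. by rewrite /fmx rtrC mulmxA spectral_unitary mul1mx rtr_dg. Qed.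

Lemma eig_le_rtr n (A : 'M[C]_n) i : psdmx A -> eig A i <= rtr A.
Proof.
move=> pA; rewrite -{2}(fmx_id (psdmx_herm pA)) rtr_fmx (bigD1 i) //= lerDl.
by apply: sumr_ge0 => j _; apply: eig_ge0.
Qed.

Lemma scalar_fmx n (A : 'M[C]_n) (k : R) : k%:C%:M = fmx (fun=> k) A.
Proof.
by rewrite -scalemx1 -(fmx1 A) fmxZ; apply: eq_fmx => i; rewrite mulr1.
Qed.

Lemma lemx_scalar n (a b : R) : a <= b -> lemx (a%:C%:M : 'M[C]_n) b%:C%:M.
Proof.
move=> ab; rewrite -[a%:C%:M]scalemx1 -[b%:C%:M]scalemx1.
exact: lemxZl (@psdmx1 R n).
Qed.

Lemma le_rtr_scalar n (A : 'M[C]_n) : psdmx A -> lemx A (rtr A)%:C%:M.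
Proof.
move=> pA; rewrite -{1}(fmx_id (psdmx_herm pA)) (scalar_fmx A).
by apply: fmx_le => i; apply: eig_le_rtr.
Qed.

Lemma eig_ge n (A : 'M[C]_n) (k : R) i : adj A = A -> lemx k%:C%:M A -> k <= eig A i.
Proof.
move=> hA /lemx_form - /(_ (row i (spectralmx A))).
by rewrite eig_row // mul_mx_scalar -!scalemxAl !rtrZ row_spectral !mulr1.
Qed.

Lemma psdmx_trmx n (A : 'M[C]_n) : psdmx A -> psdmx A^T.
Proof.
move=> pA; rewrite -(mxrpow1 pA) -mxrpow_sqrt trmx_mul.
by rewrite -{2}[mxrpow A _]adj_mxrpow -adj_trmx; apply: psdmx_gram.
Qed.

Lemma lemx_trmx n (A B : 'M[C]_n) : lemx A B -> lemx A^T B^T.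
Proof. by rewrite /lemx -linearB; apply: psdmx_trmx. Qed.

Lemma psdmx_tens m n (A : 'M[C]_m) (B : 'M[C]_n) :
  psdmx A -> psdmx B -> psdmx (A *t B).
Proof.
move=> pA pB; rewrite -(mxrpow1 pA) -(mxrpow1 pB).
rewrite -(mxrpow_sqrt A) -(mxrpow_sqrt B) -tensmx_mul.
by rewrite -{2}[mxrpow A _]adj_mxrpow -{2}[mxrpow B _]adj_mxrpow -adj_tens;
  apply: psdmx_gram.
Qed.

Lemma tensmxBl m n (A A' : 'M[C]_m) (B : 'M[C]_n) :
  (A - A') *t B = A *t B - A' *t B.
Proof. by apply/matrixP => i j; rewrite !mxE mulrBl. Qed.

Lemma tensmxBr m n (A : 'M[C]_m) (B B' : 'M[C]_n) :
  A *t (B - B') = A *t B - A *t B'.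
Proof. by apply/matrixP => i j; rewrite !mxE mulrBr. Qed.

Lemma tensmxZl m n (a : C) (A : 'M[C]_m) (B : 'M[C]_n) :
  (a *: A) *t B = a *: (A *t B).
Proof. by apply/matrixP => i j; rewrite !mxE mulrA. Qed.

Lemma tensmxZr m n (a : C) (A : 'M[C]_m) (B : 'M[C]_n) :
  A *t (a *: B) = a *: (A *t B).
Proof. by apply/matrixP => i j; rewrite !mxE mulrCA. Qed.

Lemma tensmx11 m n : (1%:M : 'M[C]_m) *t (1%:M : 'M[C]_n) = 1%:M.
Proof.
apply/matrixP => i j; case: (mxtens_indexP i) => i0 i1.
case: (mxtens_indexP j) => j0 j1; rewrite tensmxE !mxE.
rewrite (can_eq (@mxtens_indexK m n)) xpair_eqE.
by case: (i0 == j0); case: (i1 == j1); rewrite ?mulr1 ?mulr0.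
Qed.

Lemma lemx_tens m n (A A' : 'M[C]_m) (B B' : 'M[C]_n) :
  psdmx A -> psdmx B -> lemx A A' -> lemx B B' -> lemx (A *t B) (A' *t B').
Proof.
move=> pA pB hA hB; apply: (@lemx_trans _ _ (A' *t B)).
  by rewrite /lemx -tensmxBl; apply: psdmx_tens.
rewrite /lemx -tensmxBr; apply: (psdmx_tens _ hB); exact: lemx_psdmx hA.
Qed.

(** * Interpolation of operator inequalities *)

Lemma rtr_formZ n (a b : R) (x y : 'rV[C]_n) (A : 'M[C]_n) :
  rtr ((a%:C *: x) *m A *m adj (b%:C *: y)) = a * b * rtr (x *m A *m adj y).
Proof. by rewrite adjZ -scalemxAr rtrZ -scalemxAl -scalemxAl rtrZ mulrA [b * a]mulrC. Qed.

(** The block matrix with entries [H H], [H K], [K H], [K K] is a Gram matrix. With half powers for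
    [H] and [K] its off-diagonal entry is the power at the midpoint. *)
Lemma rtr_block n (H K : 'M[C]_n) (x y : 'rV[C]_n) : adj H = H -> adj K = K ->
  0 <= rtr (x *m (H *m H) *m adj x) + 2 * rtr (x *m (H *m K) *m adj y)
       + rtr (y *m (K *m K) *m adj y).
Proof.
move=> hH hK; have := rtr_gram (x *m H + y *m K).
rewrite adjD !adjM hH hK mulmxDl !mulmxDr !rtrD !mulmxA.
have -> : rtr (y *m K *m H *m adj x) = rtr (x *m H *m K *m adj y).
  by rewrite -rtr_adj !adjM adjK hH hK !mulmxA.
by move: (rtr _) (rtr _) (rtr _) => a b c; clear; lra.
Qed.

(** Scalar core of the midpoint step. Asking only for [c * c' <= r ^+ 2] avoids the square root in
    the geometric mean of the two constants. *)
Let gm_arith (c c' r l q X Y : R) : 0 < c' -> 0 < r -> 0 < q -> c * c' <= r ^+ 2 ->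
  X <= c * q -> Y <= c' * q ->
  0 <= - c' * - c' * X + 2 * (- c' * r * (l * q)) + r * r * Y -> l <= r.
Proof.
move=> c0 r0 q0 ccr h1 h2 h3.
have {h3} : 0 <= (c' * c' * c + r * r * c' - 2 * c' * r * l) * q.
  have := ler_wpM2l (mulr_ge0 (ltW c0) (ltW c0)) h1.
  have := ler_wpM2l (mulr_ge0 (ltW r0) (ltW r0)) h2.
  move: h3; lra.
rewrite pmulr_lge0 // => h4.
have h5 : 2 * c' * r * l <= 2 * c' * r * r.
  have : c' * (c * c') <= c' * r ^+ 2 by rewrite ler_wpM2l // ltW.
  move: h4; lra.
by move: h5; rewrite ler_pM2l // !mulr_gt0.
Qed.

(* The block form is tested at [(- c' v L, r v)] for a generalized eigenvector [v F = l v P]. *)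
Lemma gm_step n (Fp F Fq Pp P Pq L : 'M[C]_n) (k c c' r : R) :
  0 < k -> 0 < c' -> 0 < r -> c * c' <= r ^+ 2 ->
  adj F = F -> adj P = P -> lemx k%:C%:M P -> lemx k%:C%:M Pq ->
  (forall x y : 'rV[C]_n,
     0 <= rtr (x *m Fp *m adj x) + 2 * rtr (x *m F *m adj y)
          + rtr (y *m Fq *m adj y)) ->
  lemx Fp (c%:C *: Pp) -> lemx Fq (c'%:C *: Pq) ->
  adj L = L -> L *m Pp *m L = Pq -> L *m P = Pq ->
  lemx F (r%:C *: P).
Proof.
move=> k0 c0 r0 ccr hF hP kP kPq hb hp hq hL LPL LP.
have eP i : 0 < eig P i by apply: lt_le_trans k0 (eig_ge i hP kP).
pose S := fmx (fun x => Num.sqrt x) P; pose S' := fmx (fun x => (Num.sqrt x)^-1) P.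
have hS : adj S = S by apply: adj_fmx.
have hS' : adj S' = S' by apply: adj_fmx.
have SS : S *m S = P.
  rewrite /S fmxM -[RHS](fmx_id hP); apply: eq_fmx => i.
  by rewrite -expr2 sqr_sqrtr // ltW.
have SS' : S *m S' = 1%:M.
  rewrite /S /S' fmxM -(fmx1 P); apply: eq_fmx => i.
  by rewrite divff // gt_eqF // sqrtr_gt0.
have S'S : S' *m S = 1%:M by apply: mulmx1C.
clearbody S S'.
have hZ : adj (S' *m F *m S') = S' *m F *m S' by rewrite !adjM hS' hF mulmxA.
suff : lemx (S' *m F *m S') r%:C%:M.
  move/(lemx_conj S); rewrite hS mul_mx_scalar -scalemxAl SS !mulmxA SS' mul1mx.
  by rewrite -mulmxA S'S mulmx1.
apply: eigenvalue_le => // l w w0 hw.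
set v := w *m S'.
have vF : v *m F = l%:C *: (v *m P).
  have /(congr1 (mulmx^~ S)) := hw; rewrite /v !mulmxA -mulmxA S'S mulmx1 => ->.
  by rewrite -scalemxAl -SS mulmxA -[w *m _ *m _]mulmxA S'S mulmx1.
have v0 : v != 0.
  apply: contra_neq w0 => v0.
  by rewrite -[w]mulmx1 -S'S mulmxA -/v v0 mul0mx.
have Fv : F *m adj v = l%:C *: (P *m adj v).
  by have := congr1 (@adj R _ _) vF; rewrite adjZ !adjM hF hP.
have hb' (a b : R) (x y : 'rV[C]_n) :
    0 <= a * a * rtr (x *m Fp *m adj x) + 2 * (a * b * rtr (x *m F *m adj y))
         + b * b * rtr (y *m Fq *m adj y).
  by have := hb (a%:C *: x) (b%:C *: y); rewrite 3!rtr_formZ.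
clearbody v; set q := rtr (v *m Pq *m adj v).
have q0 : 0 < q.
  apply: (@lt_le_trans _ _ (k * rtr (v *m adj v))).
    rewrite mulr_gt0 // ltNge; apply: contra v0 => /rtr_gram0 ->; exact: eqxx.
  by have := lemx_form v kPq; rewrite mul_mx_scalar -scalemxAl rtrZ.
have := hb' (- c') r (v *m L) v; rewrite adjM hL [v *m L *m Fp *m _]mulmxA.
have E1 : rtr (v *m L *m F *m adj v) = l * q.
  by rewrite -mulmxA Fv -scalemxAr rtrZ mulmxA -[v *m L *m P]mulmxA LP.
rewrite E1.
have E2 : v *m L *m Pp *m L = v *m Pq by rewrite -LPL !mulmxA.
have h1 : rtr (v *m L *m Fp *m L *m adj v) <= c * q.
  have := lemx_form (v *m L) hp; rewrite adjM hL !mulmxA -scalemxAr -!scalemxAl rtrZ.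
  by rewrite E2.
have h2 : rtr (v *m Fq *m adj v) <= c' * q.
  by have := lemx_form v hq; rewrite -scalemxAr -scalemxAl rtrZ.
exact: (gm_arith c0 r0 q0 ccr h1 h2).
Qed.

(* Midpoint convexity halves the excess of the constant over [1] at every round,
   because each [t] is the midpoint of an endpoint and another point of [0,1];
   no continuity in [t] is needed. *)
Lemma gm_family n (F P : R -> 'M[C]_n) (k K : R) :
  0 < k ->
  (forall t, adj (F t) = F t) -> (forall t, adj (P t) = P t) ->
  (forall t, 0 <= t <= 1 -> lemx (F t) K%:C%:M) ->
  (forall t, 0 <= t <= 1 -> lemx k%:C%:M (P t)) ->
  (forall p q, 0 <= p <= 1 -> 0 <= q <= 1 -> forall x y : 'rV[C]_n,
     0 <= rtr (x *m F p *m adj x) + 2 * rtr (x *m F ((p + q) / 2) *m adj y)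
          + rtr (y *m F q *m adj y)) ->
  (forall p q, exists2 L, adj L = L &
     L *m P p *m L = P q /\ L *m P ((p + q) / 2) = P q) ->
  lemx (F 0) (P 0) -> lemx (F 1) (P 1) ->
  forall t, 0 <= t <= 1 -> lemx (F t) (P t).
Proof.
move=> k0 hF hP FK kP hb hL F0 F1.
(* The crude bounds [F t <= K] and [k <= P t] give [F t <= (1 + a) P t], the start of the
   iteration. *)
pose a := `|K| / k.
have a0 : 0 <= a by rewrite divr_ge0 // ltW.
have psdP t : 0 <= t <= 1 -> psdmx (P t).
  move=> t01; apply: lemx_psdmx (kP t t01); rewrite -scalemx1.
  exact: psdmxZ (ltW k0) (@psdmx1 R n).
suff H m t : 0 <= t <= 1 -> lemx (F t) ((1 + a / 2 ^+ m)%:C *: P t).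
  move=> t t01; apply: lemxI => // v.
  apply: (@le_of_half_powers _ _ _ (a * rtr (v *m P t *m adj v))) => m.
  have := lemx_form v (H m t t01); rewrite -scalemxAr -scalemxAl rtrZ.
  by rewrite mulrDl mul1r mulrAC.
elim: m t => [|m IH] t t01.
  rewrite expr0 divr1; apply: lemx_trans (FK t t01) _.
  apply: (@lemx_trans _ _ ((1 + a)%:C *: k%:C%:M)); last first.
    by apply: lemxZ (kP t t01); rewrite addr_ge0.
  rewrite scale_scalar_mx -rmorphM; apply: lemx_scalar.
  rewrite mulrDl mul1r divfK ?gt_eqF //.
  by rewrite (le_trans (ler_norm _)) // lerDr ltW.
set e := a / 2 ^+ m in IH; have e0 : 0 <= e by rewrite divr_ge0.
have -> : a / 2 ^+ m.+1 = e / 2.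
  by rewrite exprSr invfM mulrA.
have r0 : 0 < 1 + e / 2 by rewrite ltr_wpDr // divr_ge0.
have r1 : 0 < 1 + e by rewrite ltr_wpDr.
(* The endpoint has constant [1], the other point [1 + e]; their geometric mean is at most
   [1 + e / 2]. *)
have cr : 1 * (1 + e) <= (1 + e / 2) ^+ 2.
  by rewrite (_ : (1 + e / 2) ^+ 2 = 1 * (1 + e) + (e / 2) ^+ 2) ?lerDl ?sqr_ge0 //; field.
have step p q : 0 <= p <= 1 -> 0 <= q <= 1 -> (p + q) / 2 = t ->
    lemx (F p) (P p) -> lemx (F t) ((1 + e / 2)%:C *: P t).
  move=> p01 q01 E h; have [L hL1 [hL2 hL3]] := hL p q.
  rewrite E in hL3.
  apply: (gm_step k0 r1 r0 cr (hF t) (hP t) (kP t t01) (kP q q01) _ _ (IH q q01)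
    hL1 hL2 hL3).
    by move=> x y; rewrite -E; apply: hb.
  by rewrite rmorph1 scale1r.
have [ht|ht] := leP t (1 / 2).
  by apply: (step 0 (2 * t) _ _ _ F0); move: t01 ht; clear; lra.
by apply: (step 1 (2 * t - 1) _ _ _ F1); move: t01 ht; clear; lra.
Qed.

Lemma mxrpow_le_scalar n (A : 'M[C]_n) s : psdmx A -> 0 <= s <= 1 ->
  lemx (mxrpow A s) (1 + rtr A)%:C%:M.
Proof.
move=> pA s01; rewrite mxrpowE (scalar_fmx A); apply: fmx_le => i.
rewrite /pw; case: ifP => h; last by rewrite addr_ge0 // rtr_psd_ge0.
by apply: (le_trans (powR_le_1D h s01)); rewrite lerD2l eig_le_rtr.
Qed.

(** Powers of [A + d]. For [A >= 0] and [d > 0] they are invertible and form a group in the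
    exponent, so the factor [L] of the midpoint step exists as a power with exponent of either
    sign. *)
Definition shrpow n (d : R) (A : 'M[C]_n) s : 'M[C]_n := fmx (fun x => (x + d) `^ s) A.

Lemma adj_shrpow n d (A : 'M[C]_n) s : adj (shrpow d A s) = shrpow d A s.
Proof. exact: adj_fmx. Qed.

Lemma shrpowD n d (A : 'M[C]_n) s t : psdmx A -> 0 < d ->
  shrpow d A s *m shrpow d A t = shrpow d A (s + t).
Proof.
move=> pA d0; rewrite /shrpow fmxM; apply: eq_fmx => i.
by rewrite powR_add // ltr_wpDl // eig_ge0.
Qed.

Lemma shrpow0 n d (A : 'M[C]_n) : shrpow d A 0 = 1%:M.
Proof. by rewrite -(fmx1 A); apply: eq_fmx => i; rewrite powRr0. Qed.

Lemma le_shrpow1 n d (A : 'M[C]_n) : psdmx A -> 0 < d -> lemx A (shrpow d A 1).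
Proof.
move=> pA d0; rewrite -{1}(fmx_id (psdmx_herm pA)); apply: fmx_le => i.
by rewrite powRr1 ?lerDl ?ltW // ltr_wpDl // eig_ge0.
Qed.

Lemma scalar_le_shrpow n d (A : 'M[C]_n) s : psdmx A -> 0 < d < 1 -> 0 <= s <= 1 ->
  lemx d%:C%:M (shrpow d A s).
Proof.
move=> pA /andP[d0 d1] s01; rewrite (scalar_fmx A); apply: fmx_le => i.
by apply: le_powR_of_le => //; [rewrite d0 ltW | rewrite lerDr eig_ge0].
Qed.

Lemma shrpow_le n d e (A : 'M[C]_n) t : psdmx A -> 0 < d -> 0 < t < 1 ->
  d `^ t <= e -> lemx (shrpow d A t) (mxrpow A t + e%:C%:M).
Proof.
move=> pA d0 t01 de; rewrite mxrpowE (scalar_fmx A) fmxD; apply: fmx_le => i.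
apply: (le_trans (powR_shift_le _ d0 t01)); first exact: eig_ge0.
by rewrite lerD2l.
Qed.

(** The powers of [A] are compared with those of [B + d]: at exponent [0] by [A^0 <= 1], at exponent
    [1] by [A <= B <= B + d]. The choice of [d] makes the excess of [(B + d)^t] over [B^t] at most
    [e]. *)
Theorem lowner_heinz n (A B : 'M[C]_n) t : psdmx A -> lemx A B -> 0 < t < 1 ->
  lemx (mxrpow A t) (mxrpow B t).
Proof.
move=> pA AB t01; have pB := lemx_psdmx pA AB.
apply: lemxI; [exact: adj_mxrpow | exact: adj_mxrpow | move=> v].
apply: (@le_of_eps _ _ _ (rtr (v *m adj v))) => e /(exists_small_powR t01).
move=> [d [d01 hd _]]; have /andP[d0 d1] := d01.
have tc : 0 <= t <= 1 by case/andP: t01 => ? ?; rewrite !ltW.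
suff H : lemx (mxrpow A t) (shrpow d B t).
  apply: (le_trans (lemx_form v H)).
  apply: (le_trans (lemx_form v (shrpow_le pB d0 t01 hd))).
  by rewrite mulmxDr mulmxDl rtrD mul_mx_scalar -scalemxAl rtrZ.
apply: (@gm_family _ (mxrpow A) (shrpow d B) d (1 + rtr A)); last exact: tc.
- exact: d0.
- by move=> s; apply: adj_mxrpow.
- by move=> s; apply: adj_shrpow.
- by move=> s s01; apply: mxrpow_le_scalar.
- by move=> s s01; apply: scalar_le_shrpow.
- move=> p q _ _ x y.
  rewrite -(mxrpow_sqrt A p) -(mxrpow_sqrt A q) [(p + q) / 2]mulrDl -mxrpowD.
  by apply: rtr_block; apply: adj_mxrpow.
- move=> p q; exists (shrpow d B ((q - p) / 2)); first exact: adj_shrpow.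
  by rewrite !(shrpowD _ _ pB d0); split; congr shrpow; clear; lra.
- by rewrite shrpow0; apply: supp_le1.
- by rewrite (mxrpow1 pA); apply: (lemx_trans AB); apply: le_shrpow1.
Qed.

End MatrixPowers.

(** * Averaging over the group *)

Section Averaging.
Variables (R : realType) (G : topologicalType) (mul : G -> G -> G)
  (inv : G -> G) (one : G) (I : (G -> R) -> R).
Hypotheses (hG : is_compact_group mul inv one) (hI : is_haar_integral mul I).
Local Notation C := (R[i]).
Local Notation "x %:C" := (real_complex R x) : ring_scope.

Lemma haarD (f g : G -> R) : continuous f -> continuous g ->
  I (fun x => f x + g x) = I f + I g.
Proof. by case: hI => h _ _ _ _; apply: h. Qed.

Lemma haarZ a (f : G -> R) : continuous f -> I (fun x => a * f x) = a * I f.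
Proof. by case: hI => _ h _ _ _; apply: h. Qed.

Lemma haar_ge0 (f : G -> R) : continuous f -> (forall x, 0 <= f x) -> 0 <= I f.
Proof. by case: hI => _ _ h _ _; apply: h. Qed.

Lemma haar_cst (a : R) : I (fun=> a) = a.
Proof.
have c1 : continuous (fun _ : G => 1 : R) by move=> x; apply: cvg_cst.
by case: hI => _ h _ h1 _; have := h a _ c1; rewrite h1 mulr1.
Qed.

Lemma haar_shift h (f : G -> R) : continuous f -> I (fun x => f (mul h x)) = I f.
Proof. by case: hI => _ _ _ _ H; apply: H. Qed.

Lemma haarN (f : G -> R) : continuous f -> I (fun x => - f x) = - I f.
Proof.
move=> cf; rewrite -mulN1r -haarZ //; congr I; apply/funext => x.
by rewrite mulN1r.
Qed.

(** The functional [I] acts on real functions and is linear only on continuous ones, so both parts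
    of every complex entry have to be tracked for continuity. *)
Definition ccont (f : G -> C) : Prop :=
  continuous (fun g => complex.Re (f g)) /\ continuous (fun g => complex.Im (f g)).

Lemma contD (f g : G -> R) : continuous f -> continuous g ->
  continuous (fun x => f x + g x).
Proof. by move=> cf cg x; apply: cvgD; [exact: cf | exact: cg]. Qed.

Lemma contM (f g : G -> R) : continuous f -> continuous g ->
  continuous (fun x => f x * g x).
Proof. by move=> cf cg x; apply: cvgM; [exact: cf | exact: cg]. Qed.

Lemma contN (f : G -> R) : continuous f -> continuous (fun x => - f x).
Proof. by move=> cf x; apply: cvgN; exact: cf. Qed.

Lemma ReD (x y : C) : complex.Re (x + y) = complex.Re x + complex.Re y.
Proof. by case: x => ? ?; case: y. Qed.
Lemma ImD (x y : C) : complex.Im (x + y) = complex.Im x + complex.Im y.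
Proof. by case: x => ? ?; case: y. Qed.
Lemma ReM (x y : C) : complex.Re (x * y) =
  complex.Re x * complex.Re y + - (complex.Im x * complex.Im y).
Proof. by case: x => ? ?; case: y. Qed.
Lemma ImM (x y : C) : complex.Im (x * y) =
  complex.Re x * complex.Im y + complex.Im x * complex.Re y.
Proof. by case: x => ? ?; case: y. Qed.

Lemma ccont_cst c : ccont (fun=> c).
Proof. by split => x; apply: cvg_cst. Qed.

Lemma ccontD f g : ccont f -> ccont g -> ccont (fun x => f x + g x).
Proof.
move=> [f1 f2] [g1 g2]; split.
  by under eq_fun do rewrite ReD; apply: contD.
by under eq_fun do rewrite ImD; apply: contD.
Qed.

Lemma ccontM f g : ccont f -> ccont g -> ccont (fun x => f x * g x).
Proof.
move=> [f1 f2] [g1 g2]; split.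
  by under eq_fun do rewrite ReM; apply: contD; [|apply: contN]; apply: contM.
by under eq_fun do rewrite ImM; apply: contD; apply: contM.
Qed.

Lemma ccont_conj f : ccont f -> ccont (fun x => conjc (f x)).
Proof.
move=> [f1 f2]; split.
  by rewrite (_ : (fun g => _) = (fun g => complex.Re (f g))) //;
    apply/funext => x; case: (f x).
rewrite (_ : (fun g => _) = (fun g => - complex.Im (f g))); first exact: contN.
by apply/funext => x; case: (f x).
Qed.

Lemma ccont_sum (J : finType) (f : J -> G -> C) :
  (forall j, ccont (f j)) -> ccont (fun x => \sum_j f j x).
Proof.
move=> h; rewrite (_ : (fun x => _) = \sum_j f j); last first.
  by apply/funext => x; rewrite fct_sumE.
apply: big_rec; first exact: (ccont_cst 0).
by move=> j F _ hF; apply: ccontD.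
Qed.

Definition IC (f : G -> C) : C :=
  Complex (I (fun g => complex.Re (f g))) (I (fun g => complex.Im (f g))).

Lemma IC_cst c : IC (fun=> c) = c.
Proof. by rewrite /IC !haar_cst; case: c. Qed.

Lemma IC_add f g : ccont f -> ccont g -> IC (fun x => f x + g x) = IC f + IC g.
Proof.
move=> [f1 f2] [g1 g2].
transitivity (Complex (I (fun x => complex.Re (f x) + complex.Re (g x)))
                      (I (fun x => complex.Im (f x) + complex.Im (g x)))).
  by congr (Complex (I _) (I _)); apply/funext => x; [exact: ReD | exact: ImD].
by rewrite !haarD.
Qed.

Lemma IC_mull c f : ccont f -> IC (fun x => c * f x) = c * IC f.
Proof.
case: c => a b [f1 f2]; rewrite /IC; simpc.
have Zc k (h : G -> R) : continuous h -> continuous (fun x : G => k * h x).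
  by move=> ch; apply: contM => // x; apply: cvg_cst.
congr Complex.
  under eq_fun do rewrite ReM /=.
  rewrite haarD ?haarN ?haarZ //; first exact: Zc.
  - exact: Zc.
  - by apply: contN; apply: Zc.
under eq_fun do rewrite ImM /=.
by rewrite haarD ?haarZ //; apply: Zc.
Qed.

Lemma IC_mulr c f : ccont f -> IC (fun x => f x * c) = IC f * c.
Proof. by move=> cf; rewrite mulrC -IC_mull //; under eq_fun do rewrite mulrC. Qed.

Lemma IC_sum (J : finType) (f : J -> G -> C) : (forall j, ccont (f j)) ->
  IC (fun x => \sum_j f j x) = \sum_j IC (f j).
Proof.
move=> h; rewrite (_ : (fun x => _) = \sum_j f j); last first.
  by apply/funext => x; rewrite fct_sumE.
suff : ccont (\sum_j f j) /\ IC (\sum_j f j) = \sum_j IC (f j) by case.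
apply: (big_rec2 (fun F c => ccont F /\ IC F = c)).
  by split; [exact: (ccont_cst 0) | exact: (IC_cst 0)].
move=> j F c _ [cF <-]; split; first exact: ccontD.
exact: IC_add.
Qed.

Lemma IC_conj f : ccont f -> IC (fun x => conjc (f x)) = conjc (IC f).
Proof.
move=> [f1 f2]; rewrite /IC /= -haarN //.
by congr (Complex (I _) (I _)); apply/funext => x; case: (f x).
Qed.

Lemma IC_shift h f : ccont f -> IC (fun x => f (mul h x)) = IC f.
Proof.
move=> [f1 f2]; rewrite /IC.
by rewrite (haar_shift h f1) (haar_shift h f2).
Qed.

Definition mcont m n (f : G -> 'M[C]_(m, n)) : Prop :=
  forall i j, ccont (fun g => f g i j).

Lemma mcont_cst m n (A : 'M[C]_(m, n)) : mcont (fun=> A).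
Proof. by move=> i j; apply: ccont_cst. Qed.

Lemma mcontM m n p (f : G -> 'M[C]_(m, n)) (g : G -> 'M[C]_(n, p)) :
  mcont f -> mcont g -> mcont (fun x => f x *m g x).
Proof.
move=> cf cg i j; under eq_fun do rewrite mxE.
by apply: ccont_sum => k; apply: ccontM.
Qed.

Lemma mcont_adj m n (f : G -> 'M[C]_(m, n)) : mcont f -> mcont (fun x => adj (f x)).
Proof.
by move=> cf i j; under eq_fun do rewrite adjE; apply: ccont_conj.
Qed.

Lemma mcont_trmx m n (f : G -> 'M[C]_(m, n)) : mcont f -> mcont (fun x => (f x)^T).
Proof. by move=> cf i j; under eq_fun do rewrite mxE; apply: cf. Qed.

Lemma mcont_tens m n p q (f : G -> 'M[C]_(m, n)) (g : G -> 'M[C]_(p, q)) :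
  mcont f -> mcont g -> mcont (fun x => f x *t g x).
Proof.
by move=> cf cg i j; under eq_fun do rewrite mxE; apply: ccontM.
Qed.

Lemma mcont_sandwich m n p q (f : G -> 'M[C]_(m, n)) (g : G -> 'M[C]_(p, q)) X :
  mcont f -> mcont g -> mcont (fun x => f x *m X *m g x).
Proof. by move=> cf cg; do !apply: mcontM => //; apply: mcont_cst. Qed.

Definition IM m n (f : G -> 'M[C]_(m, n)) : 'M[C]_(m, n) :=
  \matrix_(i, j) IC (fun g => f g i j).

Lemma eq_IM m n (f g : G -> 'M[C]_(m, n)) : (forall x, f x = g x) -> IM f = IM g.
Proof. by move=> /funext ->. Qed.

Lemma IM_cst m n (A : 'M[C]_(m, n)) : IM (fun=> A) = A.
Proof. by apply/matrixP => i j; rewrite mxE IC_cst. Qed.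

(** Displays the integral as a finite linear combination of the entries of [X] with coefficients
    free of [X], so that a second integral can be pulled through. *)
Lemma IM_sandwich m n p q (f : G -> 'M[C]_(m, n)) (g : G -> 'M[C]_(p, q)) X i j :
  mcont f -> mcont g -> IM (fun x => f x *m X *m g x) i j =
  \sum_b \sum_a IC (fun x => f x i a * g x b j) * X a b.
Proof.
move=> cf cg; rewrite mxE; under eq_fun do rewrite mxE.
rewrite IC_sum; last first.
  by move=> b; apply: ccontM => //; apply: (mcontM cf (@mcont_cst _ _ X)).
apply: eq_bigr => b _; under eq_fun do rewrite mxE mulr_suml.
rewrite IC_sum; last first.
  by move=> a; do !apply: ccontM => //; apply: ccont_cst.
apply: eq_bigr => a _; under eq_fun do rewrite mulrAC.
by rewrite IC_mulr //; apply: ccontM.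
Qed.

(* The Haar functional is only given on functions of one variable; this exchange of two
   integrals follows from its linearity alone. *)
Lemma IM_swap m n p q (f : G -> 'M[C]_(m, n)) (g : G -> 'M[C]_(p, q)) h :
  mcont f -> mcont g -> mcont h ->
  IM (fun x => f x *m IM h *m g x) = IM (fun y => IM (fun x => f x *m h y *m g x)).
Proof.
move=> cf cg ch; apply/matrixP => i j; rewrite IM_sandwich //.
rewrite [RHS]mxE; under [X in IC X]eq_fun do rewrite IM_sandwich //.
rewrite IC_sum; last first.
  by move=> b; apply: ccont_sum => a; apply: ccontM => //; apply: ccont_cst.
apply: eq_bigr => b _; rewrite IC_sum; last first.
  by move=> a; apply: ccontM => //; apply: ccont_cst.
by apply: eq_bigr => a _; rewrite IC_mull // mxE.
Qed.

Lemma IM_mul2 m n p q (A : 'M[C]_(m, n)) (B : 'M[C]_(p, q)) h : mcont h ->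
  IM (fun x => A *m h x *m B) = A *m IM h *m B.
Proof.
move=> ch; have := IM_swap (@mcont_cst _ _ A) (@mcont_cst _ _ B) ch.
by rewrite IM_cst => ->; congr IM; apply/funext => y; rewrite IM_cst.
Qed.

Lemma IM_adj m n (f : G -> 'M[C]_(m, n)) : mcont f -> IM (fun x => adj (f x)) = adj (IM f).
Proof.
move=> cf; apply/matrixP => i j; rewrite adjE [IM f j i]mxE -IC_conj // mxE.
by under eq_fun do rewrite adjE.
Qed.

Lemma IM_tens m n p q (A : 'M[C]_(m, n)) (f : G -> 'M[C]_(p, q)) : mcont f ->
  IM (fun x => A *t f x) = A *t IM f.
Proof.
move=> cf; apply/matrixP => i j; rewrite mxE [RHS]mxE [IM f _ _]mxE -IC_mull //.
by under eq_fun do rewrite mxE.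
Qed.

Lemma IM_tensr m n p q (A : 'M[C]_(m, n)) (f : G -> 'M[C]_(p, q)) : mcont f ->
  IM (fun x => f x *t A) = IM f *t A.
Proof.
move=> cf; apply/matrixP => i j; rewrite mxE [RHS]mxE [IM f _ _]mxE -IC_mulr //.
by under eq_fun do rewrite mxE.
Qed.

Lemma IM_trmx m n (f : G -> 'M[C]_(m, n)) : IM (fun x => (f x)^T) = (IM f)^T.
Proof.
by apply/matrixP => i j; rewrite !mxE; under eq_fun do rewrite mxE.
Qed.

Lemma rtr_IM n (f : G -> 'M[C]_n) : mcont f -> rtr (IM f) = I (fun x => rtr (f x)).
Proof.
move=> cf; rewrite /rtr /mxtrace; under eq_bigr do rewrite mxE.
by rewrite -IC_sum.
Qed.

Lemma cont_rtr n (f : G -> 'M[C]_n) : mcont f -> continuous (fun x => rtr (f x)).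
Proof. by move=> cf; have [] : ccont (fun x => \tr (f x)) by apply: ccont_sum. Qed.

Lemma IM_psd n (f : G -> 'M[C]_n) : mcont f -> (forall x, psdmx (f x)) ->
  psdmx (IM f).
Proof.
move=> cf pf; apply: psdmxI.
  by rewrite -IM_adj //; apply: eq_IM => x; apply: psdmx_herm.
move=> v; rewrite -IM_mul2 // rtr_IM; last by do !apply: mcontM => //; apply: mcont_cst.
apply: haar_ge0; last by move=> x; apply: psdmx_form.
by apply: cont_rtr; do !apply: mcontM => //; apply: mcont_cst.
Qed.

Lemma IM_B m n (f g : G -> 'M[C]_(m, n)) : mcont f -> mcont g ->
  mcont (fun x => f x - g x) /\ IM (fun x => f x - g x) = IM f - IM g.
Proof.
move=> cf cg; have cN i j : ccont (fun x => - g x i j).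
  under eq_fun do rewrite -mulN1r.
  by apply: ccontM => //; apply: ccont_cst.
split.
  by move=> i j; under eq_fun do rewrite !mxE; apply: ccontD.
apply/matrixP => i j; rewrite !mxE; under eq_fun do rewrite !mxE.
rewrite IC_add //; congr (_ + _); under eq_fun do rewrite -mulN1r.
by rewrite IC_mull // mulN1r.
Qed.

Lemma IM_le n (f g : G -> 'M[C]_n) : mcont f -> mcont g ->
  (forall x, lemx (f x) (g x)) -> lemx (IM f) (IM g).
Proof.
move=> cf cg h; have [c E] := IM_B cg cf.
by rewrite /lemx -E; apply: IM_psd.
Qed.

Lemma rep_one n (W : G -> 'M[C]_n) : is_unitary_rep mul W -> W one = 1%:M.
Proof.
move=> [hm hu _]; case: hG => [[_ h1 _ _ _] _].
have := congr1 (mulmx^~ (adj (W one))) (hm one one).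
by rewrite h1 hu -mulmxA hu mulmx1.
Qed.

Lemma rep_inv n (W : G -> 'M[C]_n) g : is_unitary_rep mul W -> W (inv g) = adj (W g).
Proof.
move=> hW; have := rep_one hW; case: hW => [hm hu _] h1.
case: hG => [[_ _ hi _ _] _].
by rewrite -[LHS]mulmx1 -(hu g) mulmxA -hm hi h1 mul1mx.
Qed.

Definition avg n (W : G -> 'M[C]_n) (X : 'M[C]_n) : 'M[C]_n :=
  IM (fun g => W g *m X *m adj (W g)).

Section Rep.
Variables (n : nat) (W : G -> 'M[C]_n).
Hypothesis hW : is_unitary_rep mul W.

Lemma repM g h : W (mul g h) = W g *m W h. Proof. by case: hW. Qed.
Lemma rep_unitary g : W g *m adj (W g) = 1%:M. Proof. by case: hW. Qed.
Lemma rep_unitaryl g : adj (W g) *m W g = 1%:M.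
Proof. exact/unitary_adjl/rep_unitary. Qed.
Lemma rep_cont : mcont W. Proof. by case: hW. Qed.

Lemma mcont_conj X : mcont (fun g => W g *m X *m adj (W g)).
Proof. by apply: mcont_sandwich; [|apply: mcont_adj]; apply: rep_cont. Qed.

Lemma mcont_conj' X : mcont (fun g => adj (W g) *m X *m W g).
Proof. by apply: mcont_sandwich; [apply: mcont_adj|]; apply: rep_cont. Qed.

(** Conjugating by [W h] translates the integration variable from the left, which the functional
    does not see. *)
Lemma avg_comm X h : avg W X *m W h = W h *m avg W X.
Proof.
have E : W h *m avg W X *m adj (W h) = avg W X.
  rewrite /avg -IM_mul2; last exact: mcont_conj.
  rewrite -[RHS](_ : IM (fun g => W (mul h g) *m X *m adj (W (mul h g))) = _).
    by apply: eq_IM => g; rewrite repM adjM !mulmxA.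
  by apply/matrixP => i j; rewrite !mxE (IC_shift h (mcont_conj X i j)).
by rewrite -{1}E -mulmxA rep_unitaryl mulmx1.
Qed.

(* Averaging over [h] the average over [g] of [W_h^* W_g X W_g^* W_h] gives [avg W X] or its
   inverse version, according to which integral absorbs the other by left invariance. *)
Lemma avg_inverse X : IM (fun g => adj (W g) *m X *m W g) = avg W X.
Proof.
transitivity (IM (fun h => adj (W h) *m avg W X *m W h)); last first.
  rewrite -[RHS]IM_cst; apply: eq_IM => g.
  by rewrite -mulmxA avg_comm mulmxA rep_unitaryl mul1mx.
rewrite /avg IM_swap; [|apply: mcont_adj|..]; rewrite ?IM_cst; try exact: rep_cont.
  rewrite -[LHS]IM_cst; apply: eq_IM => g.
  rewrite -[LHS](_ : IM (fun h => adj (W (mul (inv g) h)) *m X *m W (mul (inv g) h)) = _).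
    apply: eq_IM => h; rewrite repM rep_inv // adjM adjK !mulmxA.
    by [].
  by apply/matrixP => i j; rewrite !mxE (IC_shift (inv g) (mcont_conj' X i j)).
exact: mcont_conj.
Qed.

(** This is a right translation, whereas the functional is only assumed left invariant. In the
    inverse form of the average it becomes the left translation by [inv g]. *)
Lemma avg_right X g : avg W (W g *m X *m adj (W g)) = avg W X.
Proof.
rewrite -!avg_inverse.
rewrite -[RHS](_ : IM (fun h => adj (W (mul (inv g) h)) *m X *m W (mul (inv g) h)) = _).
  by apply: eq_IM => h; rewrite repM rep_inv // adjM adjK !mulmxA.
by apply/matrixP => i j; rewrite !mxE (IC_shift (inv g) (mcont_conj' X i j)).
Qed.

(** The integrand is constant: by cyclicity [W g] passes through [N] and cancels. Hence tests in the
    commutant cannot distinguish a state from its average. *)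
Lemma rtr_avg X N : (forall g, N *m W g = W g *m N) ->
  rtr (avg W X *m N) = rtr (X *m N).
Proof.
move=> hN; rewrite -[avg W X]mul1mx /avg -IM_mul2; last exact: mcont_conj.
rewrite rtr_IM; last first.
  by do !apply: mcontM; (try exact: mcont_cst); [|apply: mcont_adj]; apply: rep_cont.
rewrite -[RHS]haar_cst; congr I; apply/funext => g.
rewrite mul1mx -[W g *m X *m _]mulmxA -mulmxA rtrC -mulmxA hN mulmxA.
by rewrite -[X *m _ *m W g]mulmxA rep_unitaryl mulmx1.
Qed.

Lemma rtr_avg1 X : rtr (avg W X) = rtr X.
Proof.
by rewrite -[avg W X]mulmx1 rtr_avg ?mulmx1 // => g; rewrite mulmx1 mul1mx.
Qed.

Lemma psdmx_avg X : psdmx X -> psdmx (avg W X).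
Proof. by move=> pX; apply: IM_psd; [exact: mcont_conj | move=> g; apply: psdmx_conj]. Qed.

Lemma lemx_avg X Y : lemx X Y -> lemx (avg W X) (avg W Y).
Proof.
by move=> h; apply: IM_le; try exact: mcont_conj; move=> g; apply: lemx_conj.
Qed.

End Rep.

Lemma rep_tens m n (V : G -> 'M[C]_m) (W : G -> 'M[C]_n) :
  is_unitary_rep mul V -> is_unitary_rep mul W ->
  is_unitary_rep mul (fun g => V g *t W g).
Proof.
move=> hV hW; split.
- by move=> g h; rewrite (repM hV) (repM hW) tensmx_mul.
- by move=> g; rewrite adj_tens tensmx_mul (rep_unitary hV) (rep_unitary hW) tensmx11.
- by apply: mcont_tens; apply: rep_cont.
Qed.

Lemma rep_trivial n : is_unitary_rep mul (fun=> (1%:M : 'M[C]_n)).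
Proof.
split; [by move=> *; rewrite mul1mx | by move=> *; rewrite adj1 mul1mx |].
exact: mcont_cst.
Qed.

Lemma avg_tens1 m n (W : G -> 'M[C]_n) (A : 'M[C]_m) B : is_unitary_rep mul W ->
  avg (fun g => (1%:M : 'M[C]_m) *t W g) (A *t B) = A *t avg W B.
Proof.
move=> hW; rewrite /avg -IM_tens; last exact: mcont_conj.
by apply: eq_IM => g; rewrite adj_tens !tensmx_mul adj1 mulmx1 mul1mx.
Qed.

(** In the joint average both factors carry the same [g]. The second average absorbs the rotation by
    [W g] in the second factor, leaving a product. *)
Lemma avg_tens m n (V : G -> 'M[C]_m) (W : G -> 'M[C]_n) A B :
  is_unitary_rep mul V -> is_unitary_rep mul W ->
  avg (fun g => (1%:M : 'M[C]_m) *t W g) (avg (fun g => V g *t W g) (A *t B)) =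
  avg V A *t avg W B.
Proof.
move=> hV hW; have hT := rep_tens hV hW.
have h2 := rep_tens (@rep_trivial m) hW.
rewrite {1}/avg IM_swap; [|exact: (rep_cont h2)|apply: mcont_adj; exact: (rep_cont h2)
  |exact: mcont_conj].
rewrite {2}/avg -IM_tensr; last exact: mcont_conj.
apply: eq_IM => g; rewrite -/(avg _ _) adj_tens !tensmx_mul avg_tens1 //.
by rewrite avg_right.
Qed.

End Averaging.

(** * Trace inequalities *)

Section TraceInequalities.
Variable R : realType.
Local Notation C := (R[i]).
Local Notation "x %:C" := (real_complex R x) : ring_scope.

(** Vectorization: multiplying [K] by [A] on the left and [B] on the right becomes the single matrix
    [A^T *t B], so a trace form in [K] becomes a quadratic form accessible to operator
    inequalities. *)
Definition rvec m n (K : 'M[C]_(m, n)) : 'rV[C]_(m * n) :=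
  \row_k K (mxtens_unindex k).1 (mxtens_unindex k).2.

Lemma sum_mxtens m n (F : 'I_(m * n) -> C) :
  \sum_k F k = \sum_i \sum_j F (mxtens_index (i, j)).
Proof.
rewrite pair_bigA /= (reindex (@mxtens_index m n)) /=.
  by apply: eq_bigr => -[i j] _.
exists (@mxtens_unindex m n) => k _; [exact: mxtens_indexK | exact: mxtens_unindexK].
Qed.

Lemma rvec_tens m n (A : 'M[C]_m) (B : 'M[C]_n) (K : 'M[C]_(m, n)) :
  rvec K *m (A^T *t B) = rvec (A *m K *m B).
Proof.
apply/rowP => l; case: (mxtens_indexP l) => i j.
rewrite !mxE mxtens_indexK /= sum_mxtens exchange_big /=.
apply: eq_bigr => b _; rewrite mxE mulr_suml; apply: eq_bigr => a _.
by rewrite tensmxE !mxE !mxtens_indexK /= mulrCA mulrA.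
Qed.

Lemma rtr_rvec m n (K L : 'M[C]_(m, n)) : rtr (rvec K *m adj (rvec L)) = rtr (K *m adj L).
Proof.
rewrite /rtr trace_mx11 mxE sum_mxtens /mxtrace; congr complex.Re.
apply: eq_bigr => i _; rewrite mxE; apply: eq_bigr => j _.
by rewrite !adjE !mxE !mxtens_indexK.
Qed.

Lemma rtr_rvec_form m n (A : 'M[C]_m) (B : 'M[C]_n) (K : 'M[C]_(m, n)) :
  rtr (rvec K *m (A^T *t B) *m adj (rvec K)) = rtr (A *m K *m B *m adj K).
Proof. by rewrite rvec_tens rtr_rvec. Qed.

Lemma scalar_tens m n (a b : C) :
  (a%:M : 'M[C]_m) *t (b%:M : 'M[C]_n) = (a * b)%:M.
Proof.
rewrite -[a%:M]scalemx1 -[b%:M]scalemx1 tensmxZl tensmxZr tensmx11 scalerA.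
by rewrite scalemx1.
Qed.

Lemma psdmx_scalar n (a : R) : 0 <= a -> psdmx (a%:C%:M : 'M[C]_n).
Proof. by move=> a0; rewrite -scalemx1; apply: psdmxZ (@psdmx1 R n). Qed.

Lemma rtr_sandwich_ge0 m n (A : 'M[C]_m) (B : 'M[C]_n) (K : 'M[C]_(m, n)) :
  psdmx A -> psdmx B -> 0 <= rtr (A *m K *m B *m adj K).
Proof.
move=> pA pB; rewrite -[A *m K *m B]mulmxA -mulmxA; apply: rtr_mul_ge0 pA _.
by apply: psdmx_conj.
Qed.

Lemma ler_rtr_sandwich m n (A A' : 'M[C]_m) (B B' : 'M[C]_n) (K : 'M[C]_(m, n)) :
  psdmx A -> psdmx B -> lemx A A' -> lemx B B' ->
  rtr (A *m K *m B *m adj K) <= rtr (A' *m K *m B' *m adj K).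
Proof.
move=> pA pB hA hB; have pA' := lemx_psdmx pA hA.
apply: (@le_trans _ _ (rtr (A' *m K *m B *m adj K))).
  by have := rtr_sandwich_ge0 K hA pB; rewrite !mulmxBl rtrB subr_ge0.
by have := rtr_sandwich_ge0 K pA' hB; rewrite mulmxBr mulmxBl rtrB subr_ge0.
Qed.

Lemma rtr_CS m n (a : 'M[C]_(m, n)) (b : 'M[C]_(n, m)) :
  2 * rtr (a *m b) <= rtr (a *m adj a) + rtr (b *m adj b).
Proof.
have := rtr_gram (adj a - b); rewrite adjB adjK mulmxBl !mulmxBr !rtrB.
have -> : rtr (adj a *m adj b) = rtr (a *m b) by rewrite -adjM rtr_adj rtrC.
rewrite [rtr (b *m a)]rtrC [rtr (adj a *m a)]rtrC.
by move: (rtr _) (rtr _) (rtr _) => x y z; clear; lra.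
Qed.

(* Pairs a power of [X0] with the complementary power of [X1]; this is what reduces
   statements for [1 < s < 2] to the exponent [2 - s] in [(0,1)]. *)
Lemma rtr_CS_rpow n (X0 X1 K : 'M[C]_n) s :
  psdmx X0 -> X0 *m mxrpow X1 0 = X0 ->
  2 * rtr (X0 *m adj K) <= rtr (mxrpow X0 s *m mxrpow X1 (1 - s))
    + rtr (mxrpow X0 (2 - s) *m K *m mxrpow X1 (s - 1) *m adj K).
Proof.
move=> p0 hs.
have key (A B D E P A2 B2 D2 E2 : 'M[C]_n) :
    adj A = A -> adj B = B -> adj D = D -> adj E = E ->
    A *m A = A2 -> B *m B = B2 -> D *m D = D2 -> E *m E = E2 ->
    E *m A = X0 -> B *m D = P -> X0 *m P = X0 ->
    2 * rtr (X0 *m adj K) <= rtr (A2 *m B2) + rtr (E2 *m K *m D2 *m adj K).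
  move=> hA hB hD hE <- <- <- <- EA BD XP.
  have := rtr_CS (A *m B) (D *m adj K *m E).
  rewrite !adjM adjK hA hB hD hE !mulmxA.
  have -> : rtr (A *m B *m D *m adj K *m E) = rtr (X0 *m adj K).
    by rewrite rtrC !mulmxA EA -[_ *m B *m D]mulmxA BD XP.
  rewrite [rtr (_ *m A)]rtrC !mulmxA.
  have -> : rtr (D *m adj K *m E *m E *m K *m D) = rtr (E *m E *m K *m D *m D *m adj K).
    by rewrite -!mulmxA rtrC -!mulmxA rtrC !mulmxA.
  by [].
apply: (key _ _ _ _ _ _ _ _ _ (adj_mxrpow X0 (s / 2)) (adj_mxrpow X1 ((1 - s) / 2))
  (adj_mxrpow X1 ((s - 1) / 2)) (adj_mxrpow X0 ((2 - s) / 2)) (mxrpow_sqrt _ _)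
  (mxrpow_sqrt _ _) (mxrpow_sqrt _ _) (mxrpow_sqrt _ _) _ (mxrpowD _ _ _)).
  by rewrite mxrpowD -[RHS](mxrpow1 p0); congr mxrpow; clear; lra.
by rewrite (_ : (1 - s) / 2 + (s - 1) / 2 = 0) //; clear; lra.
Qed.

Lemma fmx_scale n (c : R) (A : 'M[C]_n) f : adj A = A ->
  fmx f (c%:C *: A) = fmx (fun x => f (c * x)) A.
Proof.
move=> hA; rewrite -{1}(fmx_id hA) fmxZ [X in fmx f X]/fmx.
by rewrite fmx_diag ?spectral_unitary.
Qed.

Lemma mxrpowZ n (c : R) (A : 'M[C]_n) s : psdmx A -> 0 < c ->
  mxrpow (c%:C *: A) s = (c `^ s)%:C *: mxrpow A s.
Proof.
move=> pA c0; rewrite !mxrpowE fmx_scale ?psdmx_herm // fmxZ.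
apply: eq_fmx => i; rewrite /pw pmulr_rgt0 //; case: ifP => h; last by rewrite mulr0.
by rewrite powRM ?ltW.
Qed.

(** For the complement [S] of the support of [B], domination gives [S A S <= c S B S = 0]; this is a
    Gram matrix of [S] times the root of [A], which must vanish. *)
Lemma suppr_of_le n (A B : 'M[C]_n) (c : R) : psdmx A -> psdmx B ->
  lemx A (c%:C *: B) -> A *m mxrpow B 0 = A.
Proof.
move=> pA pB hAB; pose S := 1%:M - mxrpow B 0.
have hS : adj S = S by rewrite /S adjB adj1 adj_mxrpow.
have SB : S *m B = 0 by rewrite /S mulmxBl mul1mx mxrpow_suppl // subrr.
suff SA : S *m A = 0.
  have := congr1 (@adj R _ _) SA; rewrite adjM hS psdmx_herm // /S mulmxBr mulmx1.
  rewrite (_ : adj 0 = 0); last by rewrite -(subrr A) adjB !subrr.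
  by move/eqP; rewrite subr_eq0 => /eqP <-.
have : rtr ((S *m mxrpow A (1 / 2)) *m adj (S *m mxrpow A (1 / 2))) <= 0.
  rewrite adjM adj_mxrpow hS mulmxA -[S *m _ *m _]mulmxA mxrpow_sqrt mxrpow1 //.
  have := ler_rtr (lemx_conj S hAB); rewrite hS -scalemxAr SB scaler0 mul0mx.
  by rewrite rtr0.
move/rtr_gram0 => h; rewrite -(mxrpow1 pA) -(mxrpow_sqrt A 1) mulmxA h.
by rewrite mul0mx.
Qed.

(** Operator monotonicity at exponent [1 - s], traced against [A^s]. *)
Lemma rtr_rpow_ge n (A B : 'M[C]_n) (c s : R) : psdmx A -> psdmx B -> 0 < c ->
  lemx A (c%:C *: B) -> 0 < s < 1 ->
  rtr A <= c `^ (1 - s) * rtr (mxrpow A s *m mxrpow B (1 - s)).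
Proof.
move=> pA pB c0 hAB s01.
have s01' : 0 < 1 - s < 1 by move: s01; clear; lra.
have := ler_rtrr (lowner_heinz pA hAB s01') (psdmx_mxrpow A s).
by rewrite mxrpowD addrC subrK (mxrpow1 pA) (mxrpowZ _ pB c0) -scalemxAr rtrZ.
Qed.

(** The second moment [Tr A (Z - k)^2] is nonnegative. *)
Lemma rtr_sq_ge n (A Z : 'M[C]_n) (k : R) : psdmx A -> adj Z = Z ->
  2 * (k * rtr (A *m Z)) <= k * (k * rtr A) + rtr (A *m (Z *m Z)).
Proof.
move=> pA hZ; suff H (S : 'M[C]_n) : adj S = S ->
    2 * (k * rtr (S *m S *m Z)) <= k * (k * rtr (S *m S)) + rtr (S *m S *m (Z *m Z)).
  by have := H _ (adj_mxrpow A (1 / 2)); rewrite mxrpow_sqrt (mxrpow1 pA).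
move=> hS; have := rtr_CS (k%:C *: S) (Z *m S).
rewrite adjZ adjM hS hZ -scalemxAl rtrZ -scalemxAl rtrZ -scalemxAr rtrZ.
have -> : rtr (S *m (Z *m S)) = rtr (S *m S *m Z) by rewrite mulmxA rtrC mulmxA.
have -> : rtr (Z *m S *m (S *m Z)) = rtr (S *m S *m (Z *m Z)).
  by rewrite -mulmxA rtrC !mulmxA.
by [].
Qed.

(** With [t = s - 1] and [Z = A^(t/2) B^(-t) A^(t/2)], the trace is [Tr A Z]. Operator monotonicity
    gives [B^(-t/2) A^t B^(-t/2) <= c^t], hence [Tr A Z^2 <= c^t Tr A Z], and the second-moment
    bound with [k = c^t] turns this into [Tr A Z <= c^t Tr A]. *)
Lemma rtr_rpow_le n (A B : 'M[C]_n) (c s : R) : psdmx A -> psdmx B -> 0 < c ->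
  lemx A (c%:C *: B) -> 1 < s < 2 ->
  rtr (mxrpow A s *m mxrpow B (1 - s)) <= c `^ (s - 1) * rtr A.
Proof.
move=> pA pB c0 hAB s12; set t := s - 1.
have t01 : 0 < t < 1 by rewrite /t; move: s12; clear; lra.
have key (a b a2 b2 : 'M[C]_n) (k : R) : 0 < k -> adj a = a -> adj b = b ->
    a *m a = a2 -> b *m b = b2 ->
    lemx (b *m a2 *m b) k%:C%:M -> rtr (A *m (a *m b2 *m a)) <= k * rtr A.
  move=> k0 ha hb <- <- hk; set Z := a *m (b *m b) *m a.
  have hZ : adj Z = Z by rewrite /Z !adjM ha hb !mulmxA.
  have h1 : rtr (A *m (Z *m Z)) <= k * rtr (A *m Z).
    have E1 : rtr (b *m a *m A *m adj (b *m a)) = rtr (A *m Z).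
      by rewrite adjM ha hb -[b *m a *m A *m _]mulmxA rtrC /Z !mulmxA.
    have E2 : rtr (b *m a *m A *m adj (b *m a) *m (b *m (a *m a) *m b)) =
        rtr (A *m (Z *m Z)).
      rewrite adjM ha hb -[b *m a *m A *m _ *m _]mulmxA -[b *m a *m A *m _]mulmxA.
      by rewrite rtrC /Z !mulmxA.
    have := ler_rtrr hk (psdmx_conj (b *m a) pA).
    by rewrite E2 mul_mx_scalar rtrZ E1.
  have := rtr_sq_ge k pA hZ; move: h1 k0; clear.
  move: (rtr (A *m Z)) (rtr _) (rtr A) => x y z h1 k0 h2.
  have h3 : k * x <= k * (k * z) by move: h1 h2; clear; lra.
  by move: h3; rewrite ler_pM2l.
rewrite (_ : rtr _ = rtr (A *m (mxrpow A (t / 2) *m mxrpow B (- t) *m mxrpow A (t / 2)))).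
  apply: (key _ _ _ _ _ (powR_gt0 t c0) (adj_mxrpow A (t / 2))
    (adj_mxrpow B (- t / 2)) (mxrpow_sqrt _ _) (mxrpow_sqrt _ _)).
  have h := lemx_conj (mxrpow B (- t / 2)) (lowner_heinz pA hAB t01).
  rewrite adj_mxrpow in h; apply: (lemx_trans h).
  rewrite (mxrpowZ _ pB c0) -scalemxAr -scalemxAl mxrpowD mxrpowD.
  rewrite (_ : - t / 2 + t + - t / 2 = 0); last by clear; lra.
  have := lemxZ (powR_ge0 c t) (supp_le1 B); rewrite scalemx1.
  by [].
have cyc (a b : 'M[C]_n) : rtr (A *m (a *m b *m a)) = rtr (a *m A *m a *m b).
  by rewrite mulmxA rtrC !mulmxA.
have E : mxrpow A (t / 2) *m A *m mxrpow A (t / 2) = mxrpow A s.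
  rewrite -{2}(mxrpow1 pA) mxrpowD mxrpowD; congr mxrpow; rewrite /t; clear; lra.
by rewrite cyc E /t opprB.
Qed.

(** The weights are the squared moduli of the entries of [T] between the eigenbases of [A] and [B].
    They do not depend on [f] and [g], so inequalities between such traces reduce to scalar ones. *)
Lemma rtr_double_sum n (A B T : 'M[C]_n) : exists2 w : 'I_n -> 'I_n -> R,
  (forall i j, 0 <= w i j) &
  forall f g, rtr (fmx f A *m T *m fmx g B *m adj T) =
    \sum_i \sum_j f (eig A i) * g (eig B j) * w i j.
Proof.
pose M := spectralmx A *m T *m adj (spectralmx B).
exists (fun i j => complex.Re (M i j * conjc (M i j))).
  move=> i j; case: (M i j) => x y /=.
  by rewrite mulrN opprK addr_ge0 // -expr2 sqr_ge0.
move=> f g; rewrite (_ : rtr _ = rtr (dg (f \o eig A) *m M *m dg (g \o eig B) *m adj M)).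
  rewrite /rtr /mxtrace raddf_sum; apply: eq_bigr => i _.
  rewrite mxE raddf_sum; apply: eq_bigr => j _.
  rewrite mulr_dgE mul_dgE adjE /=; case: (M i j) => x y /=; simpc => /=.
  by ring.
rewrite /fmx /M !adjM !adjK !mulmxA [in RHS]rtrC !mulmxA.
by rewrite rtrC !mulmxA.
Qed.

Lemma rtr_rpow_expR n (A B : 'M[C]_n) :
  exists (c a : 'I_n * 'I_n -> R), (forall j, 0 <= c j) /\
  forall s, rtr (mxrpow A s *m mxrpow B (1 - s)) = \sum_j c j * expR (s * a j).
Proof.
have [w w0 h] := rtr_double_sum A B 1%:M.
(* Only pairs of positive eigenvalues [a], [b] contribute, through
   [a^s b^(1-s) = b exp(s (ln a - ln b))]. *)
exists (fun p => if (0 < eig A p.1) && (0 < eig B p.2) then w p.1 p.2 * eig B p.2 else 0).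
exists (fun p => ln (eig A p.1) - ln (eig B p.2)); split.
  by move=> p; case: ifP => // /andP[_ /ltW ?]; rewrite mulr_ge0.
move=> s; have := h (pw s) (pw (1 - s)); rewrite -!mxrpowE adj1 !mulmx1 => ->.
rewrite pair_bigA /=; apply: eq_bigr => -[i j] _ /=; rewrite /pw.
case: ltP => hi; case: ltP => hj; rewrite ?mul0r ?mulr0 ?mul0r //=.
rewrite !powRE // -expRD [LHS]mulrC -[RHS]mulrA; congr (_ * _).
rewrite [X in _ = X * _](_ : _ = expR (ln (eig B j))); last by rewrite lnK.
by rewrite -expRD; congr expR; clear; ring.
Qed.

Lemma test_sq_le n (T : 'M[C]_n) : psdmx T -> psdmx (1%:M - T) -> lemx (T *m T) T.
Proof.
move=> pT h; have hT := psdmx_herm pT.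
have e1 i : eig T i <= 1.
  have := psdmx_form (row i (spectralmx T)) h.
  rewrite mulmxBr mulmx1 eig_row // mulmxBl -scalemxAl rtrB rtrZ row_spectral.
  by rewrite mulr1 subr_ge0.
rewrite -{1 2}(fmx_id hT) fmxM -[X in lemx _ X](fmx_id hT); apply: fmx_le => i.
by rewrite ler_piMl ?eig_ge0.
Qed.

(** The quantity [V = Tr A^(2-s) T B^(s-1) T] links two estimates. Cauchy-Schwarz with [K = x T],
    taken at [x = p / V], gives [p^2 <= Q V]; the scalar inequality [a^(1-t) (y b)^t <= a + y b],
    summed over eigenvalue pairs, gives [V y^t <= p + y q]. *)
Lemma converse_bound n (A B T : 'M[C]_n) (s y : R) :
  psdmx A -> psdmx B -> A *m mxrpow B 0 = A -> psdmx T -> psdmx (1%:M - T) ->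
  1 < s < 2 -> 0 < y -> 0 < rtr (A *m T) ->
  rtr (A *m T) ^+ 2 * y `^ (s - 1) <=
  rtr (mxrpow A s *m mxrpow B (1 - s)) * (rtr (A *m T) + y * rtr (B *m T)).
Proof.
move=> pA pB hs pT hT s12 y0; set p := rtr (A *m T); set q := rtr (B *m T) => p0.
set Q := rtr (mxrpow A s *m _); set t := s - 1.
have t01 : 0 < t < 1 by rewrite /t; move: s12; clear; lra.
have q0 : 0 <= q by apply: rtr_mul_ge0.
set V := rtr (mxrpow A (2 - s) *m T *m mxrpow B (s - 1) *m T).
have TT := test_sq_le pT hT.
have hV : V * y `^ t <= p + y * q.
  have [w w0 h] := rtr_double_sum A B T; rewrite (psdmx_herm pT) in h.
  have E1 := h id (fun=> 1); rewrite fmx1 (fmx_id (psdmx_herm pA)) mulmx1 -mulmxA in E1.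
  have E2 := h (fun=> 1) id; rewrite fmx1 (fmx_id (psdmx_herm pB)) mul1mx in E2.
  have E2' : rtr (T *m B *m T) = rtr (B *m (T *m T)).
    by rewrite -mulmxA rtrC !mulmxA.
  have h1 : rtr (A *m (T *m T)) <= p by apply: ler_rtrr.
  have h2 : rtr (B *m (T *m T)) <= q by apply: ler_rtrr.
  apply: (@le_trans _ _ (rtr (A *m (T *m T)) + y * rtr (B *m (T *m T)))); last first.
    by apply: lerD => //; rewrite ler_wpM2l // ltW.
  rewrite -E2' E1 E2 /V !mxrpowE h mulr_suml mulr_sumr -big_split /=.
  apply: ler_sum => i _; rewrite mulr_suml mulr_sumr -big_split /=.
  apply: ler_sum => j _; have ai := eig_ge0 i pA; have bj := eig_ge0 j pB.
  rewrite mulr1 mul1r mulrAC mulrA -mulrDl; apply: ler_wpM2r => //.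
  rewrite /pw -/t; case: ltP => hi; last by rewrite !mul0r addr_ge0 // mulr_ge0 // ltW.
  case: ltP => hj; last by rewrite mulr0 mul0r addr_ge0 // mulr_ge0 // ltW.
  rewrite -mulrA -powRM ?(ltW y0) // [eig B j * y]mulrC.
  set a := eig A i; set b := y * eig B j.
  have a0 : 0 < a by []. have b0 : 0 < b by rewrite mulr_gt0.
  rewrite (_ : 2 - s = 1 - t); last by rewrite /t; clear; ring.
  have ab0 : 0 < a + b by rewrite addr_gt0.
  have mono r x : 0 <= r -> 0 < x -> x <= a + b -> x `^ r <= (a + b) `^ r.
    by move=> r0 x0; apply: ge0_ler_powR; rewrite ?nnegrE // ltW.
  have h3 : a `^ (1 - t) <= (a + b) `^ (1 - t).
    apply: mono => //; first by move: t01; clear; lra.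
    by rewrite lerDl ltW.
  have h4 : b `^ t <= (a + b) `^ t.
    apply: mono => //; first by move: t01; clear; lra.
    by rewrite lerDr ltW.
  apply: (le_trans (ler_pM (powR_ge0 _ _) (powR_ge0 _ _) h3 h4)).
  by rewrite powR_add ?addr_gt0 // subrK powRr1 // ltW // addr_gt0.
have h5 x : 2 * (x * p) <= Q + x * x * V.
  have := @rtr_CS_rpow _ A B (x%:C *: T) s pA hs.
  rewrite adjZ (psdmx_herm pT) -!scalemxAr -!scalemxAl !rtrZ.
  by rewrite -[x * x * V]mulrA.
have yt : 0 < y `^ t by apply: powR_gt0.
have V0 : 0 < V.
  (* If [V <= 0], the choice [x = (Q + 1) / p] would yield [2 (Q + 1) <= Q]. *)
  rewrite ltNge; apply/negP => V0; have := h5 ((Q + 1) / p).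
  rewrite divfK ?gt_eqF //; have : (Q + 1) / p * ((Q + 1) / p) * V <= 0.
    by rewrite mulr_ge0_le0 // -expr2 sqr_ge0.
  have : 0 <= Q by apply: rtr_mul_ge0; apply: psdmx_mxrpow.
  by move: (_ * V) => z; clear; lra.
have h7 : p ^+ 2 <= Q * V.
  have zV : p / V * V = p by rewrite divfK ?gt_eqF.
  have := h5 (p / V); rewrite -[p / V * _ * V]mulrA zV => h6.
  rewrite expr2 -{1}zV mulrAC; apply: ler_wpM2r; first exact: ltW.
  by move: h6; move: (p / V * p) => z; clear; lra.
have Q0 : 0 <= Q by apply: rtr_mul_ge0; apply: psdmx_mxrpow.
apply: (@le_trans _ _ (Q * (V * y `^ t))); last by rewrite ler_wpM2l.
by rewrite mulrA ler_wpM2r // ltW.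
Qed.

Definition posproj n (A : 'M[C]_n) : 'M[C]_n := fmx (fun x => if 0 < x then 1 else 0) A.

Lemma ler_rtr_sub n (A A' B B' : 'M[C]_n) : lemx A A' -> lemx B B' ->
  rtr (A *m B') - rtr (A *m B) <= rtr (A' *m B') - rtr (A' *m B).
Proof. by move=> hA hB; rewrite -!rtrB -!mulmxBr; apply: ler_rtrl. Qed.

(* With [D = B + (A - B)_+], which dominates both [A] and [B], operator monotonicity of
   fractional powers gives [Tr A - Tr A^s B^(1-s) <= Tr D - Tr B = Tr (A - B)_+]. *)
Lemma audenaert n (A B : 'M[C]_n) s : psdmx A -> psdmx B -> 0 < s < 1 ->
  rtr (A *m (1%:M - posproj (A - B))) + rtr (B *m posproj (A - B)) <=
  rtr (mxrpow A s *m mxrpow B (1 - s)).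
Proof.
move=> pA pB s01; set T := posproj _.
have s01' : 0 < 1 - s < 1 by move: s01; clear; lra.
have hAB : adj (A - B) = A - B by rewrite adjB !psdmx_herm.
pose D := fmx (fun x => if 0 < x then x else 0) (A - B).
have pD : psdmx D by apply: fmx_psd => i; case: ifP => // /ltW.
have ED : (A - B) *m T = D.
  rewrite -{1}(fmx_id hAB) fmxM; apply: eq_fmx => i.
  by case: ifP; rewrite ?mulr1 ?mulr0.
have BC : lemx B (B + D) by rewrite /lemx addrAC subrr add0r.
have AC : lemx A (B + D).
  have h : lemx (fmx id (A - B)) D by apply: fmx_le => i; case: ltP.
  rewrite (fmx_id hAB) in h.
  by have := lemxD (lemx_refl B) h; rewrite [B + (A - B)]addrC subrK.
have pC := lemx_psdmx pB BC; set E := B + D in BC AC pC *.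
have E1 X : psdmx X -> rtr X = rtr (mxrpow X s *m mxrpow X (1 - s)).
  by move=> pX; rewrite mxrpowD addrC subrK mxrpow1.
have h1 := ler_rtrr (lowner_heinz pA AC s01') (psdmx_mxrpow A s).
have h2 := ler_rtr_sub (lowner_heinz pA AC s01) (lowner_heinz pB BC s01').
have h3 := ler_rtrl (lowner_heinz pB BC s01) (psdmx_mxrpow B (1 - s)).
rewrite -(E1 _ A pA) in h1; rewrite -(E1 _ B pB) in h3; rewrite -(E1 _ E pC) in h2.
have h4 : rtr E = rtr B + (rtr (A *m T) - rtr (B *m T)).
  by rewrite rtrD -ED mulmxBl rtrB.
rewrite mulmxBr mulmx1 rtrB.
have fin (a b e x z w u v : R) : a <= x -> x - z <= e - w -> b <= w ->
  e = b + (u - v) -> a - u + v <= z by clear; lra.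
exact: fin h1 h2 h3 h4.
Qed.

Lemma dg_tens m n (l : 'I_m -> R) (k : 'I_n -> R) :
  dg l *t dg k = dg (fun i => l (mxtens_unindex i).1 * k (mxtens_unindex i).2).
Proof.
apply/matrixP => i j; case: (mxtens_indexP i) => i0 i1.
case: (mxtens_indexP j) => j0 j1; rewrite tensmxE !mxE mxtens_indexK /=.
rewrite (can_eq (@mxtens_indexK m n)) xpair_eqE.
by case: (i0 == j0); case: (i1 == j1); rewrite ?mulr1n ?mulr0n ?mulr0 ?mul0r // -rmorphM.
Qed.

Lemma mxrpow_tens m n (A : 'M[C]_m) (B : 'M[C]_n) s : psdmx A -> psdmx B ->
  mxrpow (A *t B) s = mxrpow A s *t mxrpow B s.
Proof.
move=> pA pB; rewrite !mxrpowE.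
have h f g : fmx f A *t fmx g B = adj (spectralmx A *t spectralmx B) *m
    dg (fun i => f (eig A (mxtens_unindex i).1) * g (eig B (mxtens_unindex i).2))
    *m (spectralmx A *t spectralmx B).
  by rewrite -(dg_tens (f \o eig A) (g \o eig B)) adj_tens !tensmx_mul.
rewrite -{1}(fmx_id (psdmx_herm pA)) -{1}(fmx_id (psdmx_herm pB)) !h fmx_diag.
  congr (_ *m _ *m _); apply: eq_dg => i /=; rewrite /pw.
  have a0 := eig_ge0 (mxtens_unindex i).1 pA.
  have b0 := eig_ge0 (mxtens_unindex i).2 pB.
  case: (ltgtP 0 (eig A _)) a0 => [a1 _|//|<- _]; last by rewrite mul0r ltxx mul0r.
  case: (ltgtP 0 (eig B _)) b0 => [b1 _|//|<- _]; last by rewrite mulr0 ltxx mulr0.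
  by rewrite mulr_gt0 // powRM ?ltW.
by rewrite adj_tens tensmx_mul !spectral_unitary tensmx11.
Qed.

Lemma mxtrace_tens m n (A : 'M[C]_m) (B : 'M[C]_n) : \tr (A *t B) = \tr A * \tr B.
Proof.
rewrite /mxtrace sum_mxtens mulr_suml; apply: eq_bigr => i _.
by rewrite mulr_sumr; apply: eq_bigr => j _; rewrite tensmxE.
Qed.

(** The real part of a product of two traces factorizes only because these traces are real;
    multiplicativity of [rtr] on tensor products rests on this. *)
Lemma Im_tr_mul n (A B : 'M[C]_n) : adj A = A -> adj B = B ->
  complex.Im (\tr (A *m B)) = 0.
Proof.
move=> hA hB; have : conjc (\tr (A *m B)) = \tr (A *m B).
  rewrite -[in RHS]mxtrace_mulC -{2}hA -{2}hB -adjM /mxtrace raddf_sum.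
  by apply: eq_bigr => i _; rewrite adjE.
case: (\tr _) => x y [] /eqP; rewrite eq_sym -addr_eq0 -mulr2n mulrn_eq0.
by move/eqP.
Qed.

Lemma rtr_rpow_tens m n (A A' : 'M[C]_m) (B B' : 'M[C]_n) s t :
  psdmx A -> psdmx B -> psdmx A' -> psdmx B' ->
  rtr (mxrpow (A *t B) s *m mxrpow (A' *t B') t) =
  rtr (mxrpow A s *m mxrpow A' t) * rtr (mxrpow B s *m mxrpow B' t).
Proof.
move=> pA pB pA' pB'; rewrite !mxrpow_tens // tensmx_mul /rtr mxtrace_tens.
have := Im_tr_mul (adj_mxrpow A s) (adj_mxrpow A' t).
by case: (\tr _) => x y /= ->; case: (\tr _) => x' y' /=; rewrite mul0r subr0.
Qed.

End TraceInequalities.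

(** * Monotonicity under group averages *)

Section Monotonicity.
Variables (R : realType) (G : topologicalType) (mul : G -> G -> G)
  (I : (G -> R) -> R).
Hypothesis hI : is_haar_integral mul I.
Local Notation C := (R[i]).
Local Notation "x %:C" := (real_complex R x) : ring_scope.

Lemma IM_block n (f1 f2 f3 : G -> 'M[C]_n) (x y : 'rV[C]_n) :
  mcont f1 -> mcont f2 -> mcont f3 ->
  (forall g, 0 <= rtr (x *m f1 g *m adj x) + 2 * rtr (x *m f2 g *m adj y)
                  + rtr (y *m f3 g *m adj y)) ->
  0 <= rtr (x *m IM I f1 *m adj x) + 2 * rtr (x *m IM I f2 *m adj y)
       + rtr (y *m IM I f3 *m adj y).
Proof.
move=> c1 c2 c3 h.
have cm (f : G -> 'M[C]_n) (a b : 'rV[C]_n) : mcont f -> mcont (fun g => a *m f g *m adj b).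
  move=> cf; apply: mcontM; last exact: mcont_cst.
  by apply: mcontM; [exact: mcont_cst | exact: cf].
have cr (f : G -> 'M[C]_n) (a b : 'rV[C]_n) : mcont f ->
    continuous (fun g => rtr (a *m f g *m adj b)).
  by move=> cf; apply: cont_rtr; apply: cm.
have E (f : G -> 'M[C]_n) (a b : 'rV[C]_n) : mcont f ->
    rtr (a *m IM I f *m adj b) = I (fun g => rtr (a *m f g *m adj b)).
  by move=> cf; rewrite -(IM_mul2 hI) // (rtr_IM hI) //; apply: cm.
have c22 : continuous (fun g => 2 * rtr (x *m f2 g *m adj y)).
  by apply: contM; [move=> z; apply: cvg_cst | apply: cr].
have c12 := contD (cr _ x x c1) c22.
rewrite (E _ _ _ c1) (E _ _ _ c2) (E _ _ _ c3) -(haarZ hI 2 (cr _ x y c2)).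
rewrite -(haarD hI (cr _ x x c1) c22) -(haarD hI c12 (cr _ y y c3)).
by apply: (haar_ge0 hI) => //; apply: contD c12 (cr _ y y c3).
Qed.

Lemma conj_mulmx n (W A B : 'M[C]_n) : adj W *m W = 1%:M ->
  (W *m A *m adj W) *m (W *m B *m adj W) = W *m (A *m B) *m adj W.
Proof.
by move=> h; rewrite !mulmxA -[W *m A *m adj W *m W]mulmxA h mulmx1.
Qed.

Lemma lemx_conj_scalar n (W A : 'M[C]_n) (k : R) : W *m adj W = 1%:M ->
  lemx A k%:C%:M -> lemx (W *m A *m adj W) k%:C%:M.
Proof.
move=> hW /(lemx_conj W); rewrite mul_mx_scalar -scalemxAl hW scalemx1.
by [].
Qed.

Lemma lemx_tens_scalar m n (A : 'M[C]_m) (B : 'M[C]_n) (a b : R) :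
  psdmx A -> psdmx B -> lemx A a%:C%:M -> lemx B b%:C%:M ->
  lemx (A^T *t B) (a * b)%:C%:M.
Proof.
move=> pA pB hA hB; have := lemx_tens (psdmx_trmx pA) pB (lemx_trmx hA) hB.
by rewrite tr_scalar_mx scalar_tens -rmorphM.
Qed.

Lemma scalar_le_tens m n (A : 'M[C]_m) (B : 'M[C]_n) (a b : R) :
  0 <= a -> 0 <= b -> lemx a%:C%:M A -> lemx b%:C%:M B ->
  lemx (a * b)%:C%:M (A^T *t B).
Proof.
move=> a0 b0 hA hB.
have := lemx_tens (psdmx_trmx (psdmx_scalar m a0)) (psdmx_scalar n b0)
  (lemx_trmx hA) hB.
by rewrite tr_scalar_mx scalar_tens -rmorphM.
Qed.

Lemma tens_trmx_mul m n (A A' : 'M[C]_m) (B B' : 'M[C]_n) :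
  (A^T *t B) *m (A'^T *t B') = (A' *m A)^T *t (B *m B').
Proof. by rewrite tensmx_mul trmx_mul. Qed.

Lemma adj_tens_trmx m n (A : 'M[C]_m) (B : 'M[C]_n) : adj A = A -> adj B = B ->
  adj (A^T *t B) = A^T *t B.
Proof. by move=> hA hB; rewrite adj_tens adj_trmx hA hB. Qed.

Section TensorFamily.
Variables (n : nat) (S0 S1 : R -> 'M[C]_n).
Hypotheses (S0D : forall a b, S0 a *m S0 b = S0 (a + b))
  (S1D : forall a b, S1 a *m S1 b = S1 (a + b)).

Let S s := (S0 s)^T *t S1 (1 - s).

(** [L] moves the two exponents in opposite directions, so that their sum stays equal to one. *)
Lemma tens_family_mid p q (L := (S0 ((q - p) / 2))^T *t S1 ((p - q) / 2)) :
  L *m S p *m L = S q /\ L *m S ((p + q) / 2) = S q.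
Proof.
rewrite /L /S !tens_trmx_mul !S0D !S1D.
have -> : (q - p) / 2 + (p + (q - p) / 2) = q by lra.
have -> : (p - q) / 2 + (1 - p) + (p - q) / 2 = 1 - q by lra.
have -> : (p + q) / 2 + (q - p) / 2 = q by lra.
by have -> : (p - q) / 2 + (1 - (p + q) / 2) = 1 - q by lra.
Qed.

Hypotheses (S0h : forall a, adj (S0 a) = S0 a) (S1h : forall a, adj (S1 a) = S1 a).

Lemma tens_family_block p q (x y : 'rV[C]_(n * n)) :
  0 <= rtr (x *m S p *m adj x) + 2 * rtr (x *m S ((p + q) / 2) *m adj y)
       + rtr (y *m S q *m adj y).
Proof.
pose H r := (S0 (r / 2))^T *t S1 ((1 - r) / 2).
have aH r : adj (H r) = H r by apply: adj_tens_trmx.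
have HH r r' t : (r + r') / 2 = t -> H r *m H r' = S t.
  move=> <-; rewrite /H /S tens_trmx_mul S0D S1D.
  have -> : r' / 2 + r / 2 = (r + r') / 2 by lra.
  by have -> : (1 - r) / 2 + (1 - r') / 2 = 1 - (r + r') / 2 by lra.
have := rtr_block x y (aH p) (aH q).
rewrite (HH p p p) ?(HH q q q) ?(HH p q _ erefl) //; lra.
Qed.

End TensorFamily.

(** * Lieb-type monotonicity for a pair of matrices *)

Section Lieb.
Variables (n : nat) (W : G -> 'M[C]_n).
Hypothesis hW : is_unitary_rep mul W.
Variables X0 X1 : 'M[C]_n.
Hypotheses (p0 : psdmx X0) (p1 : psdmx X1).

Let cj (A : 'M[C]_n) g := W g *m A *m adj (W g).
(** The integral is taken after powers and tensor product, so the block condition holds for each [g]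
    and survives integration; the dominating family uses powers of the averages instead. *)
Let F s := IM I (fun g => (cj (mxrpow X0 s) g)^T *t cj (mxrpow X1 (1 - s)) g).

Let cF s : mcont (fun g => (cj (mxrpow X0 s) g)^T *t cj (mxrpow X1 (1 - s)) g).
Proof.
by apply: mcont_tens; [apply: mcont_trmx|]; apply: (mcont_conj hW).
Qed.

Let pcj s A g : psdmx (cj (mxrpow A s) g).
Proof. exact: psdmx_conj (psdmx_mxrpow A s). Qed.

Let cjD A a b g : cj (mxrpow A a) g *m cj (mxrpow A b) g = cj (mxrpow A (a + b)) g.
Proof. by rewrite /cj conj_mulmx ?mxrpowD //; apply: (rep_unitaryl hW). Qed.

(** At either endpoint one factor has exponent [0] and is at most the identity, while the other
    enters linearly and integrates to the average. *)
Let lieb_shift d t : 0 < d < 1 -> 0 <= t <= 1 ->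
  lemx (F t) ((shrpow d (avg I W X0) t)^T *t shrpow d (avg I W X1) (1 - t)).
Proof.
move=> d01; have /andP[d0 d1] := d01.
have q0 := psdmx_avg hI hW p0; have q1 := psdmx_avg hI hW p1.
have c01 (s : R) : 0 <= s <= 1 -> 0 <= 1 - s <= 1 by lra.
apply: (@gm_family _ _ F (fun t => (shrpow d (avg I W X0) t)^T *t
  shrpow d (avg I W X1) (1 - t)) (d * d) ((1 + rtr X0) * (1 + rtr X1))).
- exact: mulr_gt0.
- move=> s; apply: psdmx_herm; apply: (IM_psd hI (cF s)) => g.
  by apply: psdmx_tens; [apply: psdmx_trmx|]; apply: pcj.
- by move=> s; apply: adj_tens_trmx; apply: adj_shrpow.
- move=> s s01; rewrite -[X in lemx _ X](IM_cst hI).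
  apply: (IM_le hI (cF s)); first exact: mcont_cst.
  move=> g; apply: lemx_tens_scalar; [exact: pcj | exact: pcj |..].
    apply: lemx_conj_scalar; first exact: (rep_unitary hW).
    exact: mxrpow_le_scalar.
  apply: lemx_conj_scalar; first exact: (rep_unitary hW).
  by apply: mxrpow_le_scalar => //; apply: c01.
- move=> s s01; apply: scalar_le_tens; [exact: ltW | exact: ltW |..].
    exact: scalar_le_shrpow.
  by apply: scalar_le_shrpow => //; apply: c01.
- move=> p q _ _ x y; apply: IM_block; [exact: cF | exact: cF | exact: cF |].
  move=> g; apply: (@tens_family_block _ (fun s => cj (mxrpow X0 s) g)
    (fun s => cj (mxrpow X1 s) g)) => *; try exact: cjD; exact/psdmx_herm/pcj.
- move=> p q; eexists; last exact: (tens_family_mid (fun a b => shrpowD a b q0 d0)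
    (fun a b => shrpowD a b q1 d0)).
  by apply: adj_tens_trmx; apply: adj_shrpow.
- rewrite shrpow0 /F subr0 trmx1.
  apply: (@lemx_trans _ _ (IM I (fun g => 1%:M *t cj X1 g))).
    apply: (IM_le hI); [by have := cF 0; rewrite subr0 | | ].
      by apply: mcont_tens; [exact: mcont_cst | exact: (mcont_conj hW)].
    move=> g; rewrite (mxrpow1 p1).
    apply: lemx_tens; [exact/psdmx_trmx/pcj | exact: psdmx_conj p1 | |exact: lemx_refl].
    rewrite -[X in lemx _ X]trmx1; apply: lemx_trmx.
    have := lemx_conj (W g) (supp_le1 X0); rewrite mulmx1 (rep_unitary hW).
    by [].
  rewrite (IM_tens hI); last exact: (mcont_conj hW).
  by apply: lemx_tens; [exact: psdmx1 | exact: q1 | exact: lemx_refl | exact: le_shrpow1 q1 d0].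
- rewrite subrr shrpow0 /F subrr.
  apply: (@lemx_trans _ _ (IM I (fun g => (cj X0 g)^T *t 1%:M))).
    apply: (IM_le hI); [by have := cF 1; rewrite subrr | | ].
      by apply: mcont_tens; [apply: mcont_trmx; exact: (mcont_conj hW) | exact: mcont_cst].
    move=> g; rewrite (mxrpow1 p0).
    apply: lemx_tens; [exact/psdmx_trmx/psdmx_conj | exact: pcj |exact: lemx_refl |].
    have := lemx_conj (W g) (supp_le1 X1); rewrite mulmx1 (rep_unitary hW).
    by [].
  rewrite (IM_tensr hI); last by apply: mcont_trmx; exact: (mcont_conj hW).
  rewrite IM_trmx; apply: lemx_tens; [|exact: psdmx1| |exact: lemx_refl].
    exact: psdmx_trmx q0.
  exact: lemx_trmx (le_shrpow1 q0 d0).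
Qed.

(** Evaluated at [rvec K], the integrand of [F t] does not depend on [g], since [K] commutes with
    the representation; it equals the left side. *)
Lemma lieb_avg (K : 'M[C]_n) t : (forall g, K *m W g = W g *m K) -> 0 < t < 1 ->
  rtr (mxrpow X0 t *m K *m mxrpow X1 (1 - t) *m adj K) <=
  rtr (mxrpow (avg I W X0) t *m K *m mxrpow (avg I W X1) (1 - t) *m adj K).
Proof.
move=> hK t01; have q0 := psdmx_avg hI hW p0; have q1 := psdmx_avg hI hW p1.
have t01' : 0 < 1 - t < 1 by move: t01; lra.
set Y0 := avg I W X0 in q0 *; set Y1 := avg I W X1 in q1 *.
(* Coefficient of the error after expanding both factors shifted by [e], with [e^2 <= e] for the
   last term. *)
pose z := rtr (mxrpow Y0 t *m K *m adj K) + rtr (K *m mxrpow Y1 (1 - t) *m adj K)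
  + rtr (K *m adj K).
apply: (@le_of_eps _ _ _ z) => e e01; have [d [d01 hd hd']] := exists_small_powR t01 e01.
have /andP[d0 _] := d01; have /andP[e0 e1] := e01.
have tc : 0 <= t <= 1 by case/andP: t01 => ? ?; rewrite !ltW.
have := lemx_form (rvec K) (lieb_shift d01 tc); rewrite rtr_rvec_form.
have -> : rtr (rvec K *m F t *m adj (rvec K)) =
    rtr (mxrpow X0 t *m K *m mxrpow X1 (1 - t) *m adj K).
  rewrite /F -(IM_mul2 hI); last exact: cF.
  rewrite (rtr_IM hI); last first.
    by apply: mcontM; [apply: mcontM; [exact: mcont_cst|exact: cF] | exact: mcont_cst].
  rewrite -[RHS](haar_cst hI); congr I; apply/funext => g.
  rewrite rtr_rvec_form /cj.
  have cyc (A B V : 'M[C]_n) : adj V *m V = 1%:M -> K *m V = V *m K ->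
      rtr (V *m A *m adj V *m K *m (V *m B *m adj V) *m adj K) =
      rtr (A *m K *m B *m adj K).
    move=> hV KV; have VK : adj V *m adj K = adj K *m adj V by rewrite -!adjM KV.
    rewrite !mulmxA -[_ *m K *m V]mulmxA KV !mulmxA.
    rewrite -[V *m A *m adj V *m V]mulmxA hV mulmx1 -[_ *m adj V *m adj K]mulmxA VK.
    by rewrite !mulmxA rtrC !mulmxA hV mul1mx.
  by apply: cyc; [exact: (rep_unitaryl hW) | exact: hK].
move=> h; apply: (le_trans h) => {h}.
have s0 := lemx_psdmx (psdmx_scalar n (ltW d0)) (scalar_le_shrpow q0 d01 tc).
have tc' : 0 <= 1 - t <= 1 by case/andP: t01' => ? ?; rewrite !ltW.
have s1 := lemx_psdmx (psdmx_scalar n (ltW d0)) (scalar_le_shrpow q1 d01 tc').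
apply: (le_trans (ler_rtr_sandwich K s0 s1 (shrpow_le q0 d0 t01 hd)
  (shrpow_le q1 d0 t01' hd'))).
have ex (A B : 'M[C]_n) : rtr ((A + e%:C%:M) *m K *m (B + e%:C%:M) *m adj K) =
    rtr (A *m K *m B *m adj K) + e * (rtr (A *m K *m adj K) + rtr (K *m B *m adj K)
    + e * rtr (K *m adj K)).
  rewrite !mulmxDl !mulmxDr !mulmxDl !rtrD !mul_mx_scalar !mul_scalar_mx.
  rewrite -!scalemxAl !rtrZ.
  by move: (rtr _) (rtr _) (rtr _) (rtr _) => x1 x2 x3 x4; ring.
rewrite ex lerD2l ler_wpM2l ?(ltW e0) // lerD2l ler_piMl ?(ltW e1) //.
exact: rtr_gram.
Qed.

Lemma avg_rpow_comm X s g : psdmx X ->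
  mxrpow (avg I W X) s *m W g = W g *m mxrpow (avg I W X) s.
Proof.
move=> pX; have hX := psdmx_herm (psdmx_avg hI hW pX).
by rewrite mxrpowE; apply: fmx_intertwine => //; apply: (avg_comm hI hW).
Qed.

Lemma rtr_rpow_avg_le s : 0 < s < 1 ->
  rtr (mxrpow X0 s *m mxrpow X1 (1 - s)) <=
  rtr (mxrpow (avg I W X0) s *m mxrpow (avg I W X1) (1 - s)).
Proof.
move=> s01; have := @lieb_avg 1%:M s _ s01; rewrite adj1 !mulmx1; apply.
by move=> g; rewrite mulmx1 mul1mx.
Qed.

Lemma rtr_rpow_avg_ge s : X0 *m mxrpow X1 0 = X0 -> 1 < s < 2 ->
  rtr (mxrpow (avg I W X0) s *m mxrpow (avg I W X1) (1 - s)) <=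
  rtr (mxrpow X0 s *m mxrpow X1 (1 - s)).
Proof.
move=> hs s12; have q0 := psdmx_avg hI hW p0.
set Y0 := avg I W X0 in q0 *; set Y1 := avg I W X1.
(* This [K] gives equality in Cauchy-Schwarz for the averaged pair: both terms containing [K] become
   [Q] there, and [2 Q <= Q_X + Q] remains, where [Q_X] is the trace for [X0] and [X1]. *)
pose K := mxrpow Y0 (s - 1) *m mxrpow Y1 (1 - s).
have aK : adj K = mxrpow Y1 (1 - s) *m mxrpow Y0 (s - 1).
  by rewrite /K adjM; congr (_ *m _); apply: adj_mxrpow.
have cm (A B : 'M[C]_n) g : A *m W g = W g *m A -> B *m W g = W g *m B ->
    A *m B *m W g = W g *m (A *m B).
  by move=> hA hB; rewrite -mulmxA hB mulmxA hA mulmxA.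
have hK g : K *m W g = W g *m K by apply: cm; apply: avg_rpow_comm.
have hK' g : adj K *m W g = W g *m adj K.
  by rewrite aK; apply: cm; apply: avg_rpow_comm.
have t01 : 0 < 2 - s < 1 by move: s12; lra.
have h1 := rtr_CS_rpow K s p0 hs.
have h2 := lieb_avg hK t01.
have E0 : 1 - (2 - s) = s - 1 by ring.
rewrite E0 -/Y0 -/Y1 in h2.
rewrite -(rtr_avg hI hW X0 hK') -/Y0 in h1.
set Q := rtr (mxrpow Y0 s *m _).
have E1 : rtr (Y0 *m adj K) = Q.
  have cyc (A B D : 'M[C]_n) : rtr (D *m (A *m B)) = rtr ((B *m D) *m A).
    by rewrite mulmxA rtrC mulmxA.
  rewrite aK cyc -{2}(mxrpow1 q0) mxrpowD subrK.
  by [].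
have E2 : rtr (mxrpow Y0 (2 - s) *m K *m mxrpow Y1 (s - 1) *m adj K) = Q.
  have cyc (A B D E : 'M[C]_n) :
      rtr (A *m (B *m D) *m E *m (D *m B)) = rtr ((B *m A *m B) *m (D *m E *m D)).
    by rewrite !mulmxA rtrC !mulmxA.
  rewrite aK (cyc (mxrpow Y0 (2 - s)) (mxrpow Y0 (s - 1)) (mxrpow Y1 (1 - s))
    (mxrpow Y1 (s - 1))) (mxrpowD Y0 (s - 1) (2 - s)) (mxrpowD Y1 (1 - s) (s - 1)).
  rewrite (mxrpowD Y0 _ (s - 1)) (mxrpowD Y1 _ (1 - s)).
  have -> : s - 1 + (2 - s) + (s - 1) = s by ring.
  by have -> : 1 - s + (s - 1) + (1 - s) = 1 - s by ring.
rewrite E1 in h1; rewrite E2 in h2.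
by move: h1 h2; move: (rtr (_ *m adj K)) => x; move: (rtr _) => y; lra.
Qed.

End Lieb.

End Monotonicity.

(** * Tensor powers *)

Section TensorPowers.
Variable R : realType.
Local Notation C := (R[i]).
Local Notation "x %:C" := (real_complex R x) : ring_scope.

Lemma castmx_mulmx m n (e : m = n) (A B : 'M[C]_m) :
  castmx (e, e) (A *m B) = castmx (e, e) A *m castmx (e, e) B.
Proof. by case: n / e. Qed.

Lemma castmx_adj m n (e : m = n) (A : 'M[C]_m) :
  castmx (e, e) (adj A) = adj (castmx (e, e) A).
Proof. by case: n / e. Qed.

Lemma castmx1 m n (e : m = n) : castmx (e, e) (1%:M : 'M[C]_m) = 1%:M.
Proof. by case: n / e. Qed.

Lemma rtr_rpow_castmx m n (e : m = n) (A B : 'M[C]_m) s t :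
  rtr (mxrpow (castmx (e, e) A) s *m mxrpow (castmx (e, e) B) t) =
  rtr (mxrpow A s *m mxrpow B t).
Proof. by case: n / e. Qed.

Lemma mxtrace_castmx m n (e : m = n) (A : 'M[C]_m) : \tr (castmx (e, e) A) = \tr A.
Proof. by case: n / e. Qed.

Lemma psdmx_castmx m n (e : m = n) (A : 'M[C]_m) : psdmx A -> psdmx (castmx (e, e) A).
Proof. by case: n / e. Qed.

Lemma lemx_castmx m n (e : m = n) (A B : 'M[C]_m) :
  lemx A B -> lemx (castmx (e, e) A) (castmx (e, e) B).
Proof. by case: n / e. Qed.

Lemma castmxZ m n (e : m = n) (a : C) (A : 'M[C]_m) :
  castmx (e, e) (a *: A) = a *: castmx (e, e) A.
Proof. by case: n / e. Qed.

Lemma castmx_tensl m m' n (e : m = m') (f : (m * n = m' * n)%N)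
    (A : 'M[C]_m) (B : 'M[C]_n) :
  castmx (e, e) A *t B = castmx (f, f) (A *t B).
Proof. by case: m' / e f => f; rewrite !castmx_id. Qed.

Lemma castmx_tensr m n n' (e : n = n') (f : (m * n = m * n')%N)
    (A : 'M[C]_m) (B : 'M[C]_n) :
  A *t castmx (e, e) B = castmx (f, f) (A *t B).
Proof. by case: n' / e f => f; rewrite !castmx_id. Qed.

Lemma tensmxA m n p (e : (m * n * p = m * (n * p))%N)
    (A : 'M[C]_m) (B : 'M[C]_n) (D : 'M[C]_p) :
  castmx (e, e) (A *t B *t D) = A *t (B *t D).
Proof.
have idx (i : 'I_m) (j : 'I_n) (k : 'I_p) :
    cast_ord (esym e) (mxtens_index (i, mxtens_index (j, k))) =
    mxtens_index (mxtens_index (i, j), k).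
  by apply: val_inj; rewrite /= mulnDl mulnA addnA.
apply/matrixP => i j.
case: (mxtens_indexP i) => i0 i'; case: (mxtens_indexP i') => i1 i2.
case: (mxtens_indexP j) => j0 j'; case: (mxtens_indexP j') => j1 j2.
by rewrite castmxE /= !idx !tensmxE mulrA.
Qed.

Variable d : nat.
Implicit Types (A B : 'M[C]_d).

Lemma tpowM n A B : tpow n (A *m B) = tpow n A *m tpow n B.
Proof.
elim: n => [|n IH] /=; first by rewrite -castmx_mulmx mulmx1.
by rewrite -castmx_mulmx tensmx_mul -IH.
Qed.

Lemma tpow_adj n A : tpow n (adj A) = adj (tpow n A).
Proof.
elim: n => [|n IH] /=; first by rewrite -castmx_adj adj1.
by rewrite -castmx_adj adj_tens -IH.
Qed.

Lemma tpow1 n : tpow n (1%:M : 'M[C]_d) = 1%:M.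
Proof.
elim: n => [|n IH] /=; first by rewrite castmx1.
by rewrite IH tensmx11 castmx1.
Qed.

Lemma tpow_psd n A : psdmx A -> psdmx (tpow n A).
Proof.
move=> pA; elim: n => [|n IH] /=; apply: psdmx_castmx; first exact: psdmx1.
exact: psdmx_tens.
Qed.

Lemma mxtrace_tpow n A : \tr (tpow n A) = (\tr A) ^+ n.
Proof.
elim: n => [|n IH] /=; rewrite mxtrace_castmx; first by rewrite mxtrace1.
by rewrite mxtrace_tens IH exprSr.
Qed.

Lemma tpow_le n A B (c : R) : psdmx A -> lemx A (c%:C *: B) ->
  lemx (tpow n A) ((c ^+ n)%:C *: tpow n B).
Proof.
move=> pA h; elim: n => [|n IH] /=.
  by rewrite expr0 rmorph1 scale1r; apply: lemx_refl.
rewrite -castmxZ; apply: lemx_castmx.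
have := lemx_tens (tpow_psd n pA) pA IH h.
by rewrite tensmxZl tensmxZr scalerA -rmorphM exprSr.
Qed.

(** The recursion on [m] appends factors on the right, hence the order [n] before [m]. The dimension
    equation is arbitrary, so the casts can be composed freely. *)
Lemma tpow_add m n (e : (d ^ n * d ^ m = d ^ (m + n))%N) A :
  tpow (m + n) A = castmx (e, e) (tpow n A *t tpow m A).
Proof.
elim: m e => [|m IH] e.
  rewrite /= castmx1 add0n in e *; rewrite tens_mx_scalar scale1r castmx_comp castmx_id.
  by [].
have e1 : (d ^ n * d ^ m = d ^ (m + n))%N by rewrite -expnD addnC.
have e2 : (d ^ n * d ^ m * d = d ^ (m + n) * d)%N by rewrite e1.
have e3 : (d ^ n * (d ^ m * d) = d ^ n * d ^ m.+1)%N by rewrite expnSr.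
have e4 : (d ^ n * d ^ m * d = d ^ n * (d ^ m * d))%N by rewrite mulnA.
rewrite [LHS]/= [tpow m.+1 A]/= (IH e1) (castmx_tensl _ e2) (castmx_tensr _ e3).
by rewrite -(tensmxA e4) !castmx_comp; congr (castmx (_, _) _); apply: nat_irrelevance.
Qed.

End TensorPowers.

(** * The averaged states and their trace functional *)

Section AveragedStates.
Variables (R : realType) (G : topologicalType) (mul : G -> G -> G)
  (inv : G -> G) (one : G) (I : (G -> R) -> R).
Hypotheses (hG : is_compact_group mul inv one) (hI : is_haar_integral mul I).
Local Notation C := (R[i]).
Local Notation "x %:C" := (real_complex R x) : ring_scope.
Variables (d : nat) (u : G -> 'M[C]_d).
Hypothesis hu : is_unitary_rep mul u.

Lemma mcont_castmx m n (e : m = n) (f : G -> 'M[C]_m) :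
  mcont f -> mcont (fun g => castmx (e, e) (f g)).
Proof. by case: n / e. Qed.

Lemma castmx_avg m n (e : m = n) (W : G -> 'M[C]_m) X :
  castmx (e, e) (avg I W X) = avg I (fun g => castmx (e, e) (W g)) (castmx (e, e) X).
Proof. by case: n / e. Qed.

Lemma rep_tpow n : is_unitary_rep mul (fun g => tpow n (u g)).
Proof.
split.
- by move=> g h; rewrite (repM hu) tpowM.
- by move=> g; rewrite -tpow_adj -tpowM (rep_unitary hu) tpow1.
- elim: n => [|n IH] /=; apply: mcont_castmx; first exact: mcont_cst.
  by apply: mcont_tens => //; apply: (rep_cont hu).
Qed.

Lemma avgZ n (W : G -> 'M[C]_n) (a : R) X : is_unitary_rep mul W ->
  avg I W (a%:C *: X) = a%:C *: avg I W X.
Proof.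
move=> hW; rewrite -[RHS]mul_scalar_mx -[RHS]mulmx1 /avg -(IM_mul2 hI).
  by apply: eq_IM => g; rewrite mulmx1 mul_scalar_mx -scalemxAr -scalemxAl.
exact: (mcont_conj hW).
Qed.

Definition avgstate (rho : 'M[C]_d) n : 'M[C]_(d ^ n) := E_An I u (tpow n rho).

Lemma avgstateE rho n : avgstate rho n = avg I (fun g => tpow n (u g)) (tpow n rho).
Proof. by []. Qed.

Lemma psdmx_avgstate rho n : psdmx rho -> psdmx (avgstate rho n).
Proof. by move=> p; rewrite avgstateE; apply: (psdmx_avg hI (rep_tpow n)); apply: tpow_psd. Qed.

Lemma rtr_avgstate rho n : density rho -> rtr (avgstate rho n) = 1.
Proof.
move=> [_ t]; rewrite avgstateE (rtr_avg1 hI (rep_tpow n)).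
by rewrite /rtr mxtrace_tpow t expr1n.
Qed.

Lemma avgstate_le rho0 rho1 (c : R) n : psdmx rho0 -> lemx rho0 (c%:C *: rho1) ->
  lemx (avgstate rho0 n) ((c ^+ n)%:C *: avgstate rho1 n).
Proof.
move=> p h; rewrite !avgstateE -avgZ; last exact: rep_tpow.
by apply: (lemx_avg hI (rep_tpow n)); apply: tpow_le.
Qed.

Lemma rtr_avgstate_test rho n (T : 'M[C]_(d ^ n)) : in_An u T ->
  rtr (tpow n rho *m T) = rtr (avgstate rho n *m T).
Proof. by move=> hT; rewrite avgstateE (rtr_avg hI (rep_tpow n)). Qed.

(** This is [Q_n(s)]; [psi_n] is convertible to its logarithm. *)
Definition qsum (rho0 rho1 : 'M[C]_d) n (s : R) : R :=
  rtr (mxrpow (avgstate rho0 n) s *m mxrpow (avgstate rho1 n) (1 - s)).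

Section QSum.
Variables (rho0 rho1 : 'M[C]_d) (c : R).
Hypotheses (h0 : density rho0) (h1 : density rho1) (c0 : 0 < c)
  (hc : lemx rho0 (c%:C *: rho1)).

Let p0 : psdmx rho0. Proof. by case: h0. Qed.
Let p1 : psdmx rho1. Proof. by case: h1. Qed.

Lemma avgstate_supp n : avgstate rho0 n *m mxrpow (avgstate rho1 n) 0 = avgstate rho0 n.
Proof.
exact: suppr_of_le (psdmx_avgstate n p0) (psdmx_avgstate n p1) (avgstate_le n p0 hc).
Qed.

Lemma qsum1 n : qsum rho0 rho1 n 1 = 1.
Proof.
by rewrite /qsum subrr (mxrpow1 (psdmx_avgstate n p0)) avgstate_supp rtr_avgstate.
Qed.

Lemma qsum_ge n s : 0 < s < 1 -> 1 <= (c ^+ n) `^ (1 - s) * qsum rho0 rho1 n s.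
Proof.
move=> s01; rewrite -{1}(rtr_avgstate n h0).
exact: rtr_rpow_ge (psdmx_avgstate n p0) (psdmx_avgstate n p1) (exprn_gt0 n c0)
  (avgstate_le n p0 hc) s01.
Qed.

Lemma qsum_le n s : 1 < s < 2 -> qsum rho0 rho1 n s <= (c ^+ n) `^ (s - 1).
Proof.
move=> s12; have := rtr_rpow_le (psdmx_avgstate n p0) (psdmx_avgstate n p1)
  (exprn_gt0 n c0) (avgstate_le n p0 hc) s12.
by rewrite (rtr_avgstate n h0) mulr1.
Qed.

(** [V] rotates only the last [m] factors. [X] is, up to a cast, the averaged state on [m + n]
    factors, and its average over [V] is a product. *)
Let V m n g := (1%:M : 'M[C]_(d ^ n)) *t tpow m (u g).
Let X rho m n := avg I (fun g => tpow n (u g) *t tpow m (u g)) (tpow n rho *t tpow m rho).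

Let hV m n : is_unitary_rep mul (V m n).
Proof. exact: rep_tens (rep_trivial R mul _) (rep_tpow m). Qed.

Let avgX rho m n : avg I (V m n) (X rho m n) = avgstate rho n *t avgstate rho m.
Proof. exact: (avg_tens hG hI _ _ (rep_tpow n) (rep_tpow m)). Qed.

Let psdX rho m n : psdmx rho -> psdmx (X rho m n).
Proof.
move=> p; apply: (psdmx_avg hI (rep_tens (rep_tpow n) (rep_tpow m))).
by apply: psdmx_tens; apply: tpow_psd.
Qed.

Let suppX m n : X rho0 m n *m mxrpow (X rho1 m n) 0 = X rho0 m n.
Proof.
have hT := rep_tens (rep_tpow n) (rep_tpow m).
apply: (@suppr_of_le _ _ _ _ (c ^+ n * c ^+ m)); [exact: psdX | exact: psdX |].
rewrite /X -(avgZ _ _ hT); apply: (lemx_avg hI hT).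
have := lemx_tens (tpow_psd n p0) (tpow_psd m p0) (tpow_le n p0 hc) (tpow_le m p0 hc).
by rewrite tensmxZl tensmxZr scalerA -rmorphM.
Qed.

Let qsum_addE m n s : qsum rho0 rho1 (m + n) s =
  rtr (mxrpow (X rho0 m n) s *m mxrpow (X rho1 m n) (1 - s)).
Proof.
have e : (d ^ n * d ^ m = d ^ (m + n))%N by rewrite -expnD addnC.
have E rho : avgstate rho (m + n) = castmx (e, e) (X rho m n).
  rewrite avgstateE /X castmx_avg (tpow_add e); congr (avg I _ _).
  by apply/funext => g; rewrite (tpow_add e).
by rewrite /qsum !E rtr_rpow_castmx.
Qed.

Let qsum_mulE m n s : qsum rho0 rho1 n s * qsum rho0 rho1 m s =
  rtr (mxrpow (avg I (V m n) (X rho0 m n)) s *m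
       mxrpow (avg I (V m n) (X rho1 m n)) (1 - s)).
Proof.
rewrite !avgX; symmetry; apply: rtr_rpow_tens; exact: psdmx_avgstate.
Qed.

Lemma qsum_sub m n s : 0 < s < 1 ->
  qsum rho0 rho1 (m + n) s <= qsum rho0 rho1 n s * qsum rho0 rho1 m s.
Proof.
move=> s01; rewrite qsum_addE qsum_mulE.
exact: (rtr_rpow_avg_le hI (hV m n) (psdX m n p0) (psdX m n p1) s01).
Qed.

Lemma qsum_super m n s : 1 < s < 2 ->
  qsum rho0 rho1 n s * qsum rho0 rho1 m s <= qsum rho0 rho1 (m + n) s.
Proof.
move=> s12; rewrite qsum_addE qsum_mulE.
exact: (rtr_rpow_avg_ge hI (hV m n) (psdX m n p0) (psdX m n p1) (suppX m n) s12).
Qed.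

Lemma qsum_expR n : exists (a b : 'I_(d ^ n) * 'I_(d ^ n) -> R),
  (forall j, 0 <= a j) /\ forall s, qsum rho0 rho1 n s = \sum_j a j * expR (s * b j).
Proof. exact: rtr_rpow_expR. Qed.

Lemma beta0E n (T : 'M[C]_(d ^ n)) : in_An u T ->
  rtr (avgstate rho0 n *m T) = 1 - beta0 rho0 T.
Proof.
move=> hT; rewrite -(rtr_avgstate_test _ hT) /beta0 -/(rtr _) mulmxBr mulmx1 rtrB.
by rewrite {2}/rtr mxtrace_tpow; case: h0 => _ ->; rewrite expr1n opprB addrC subrK.
Qed.

Lemma beta1E n (T : 'M[C]_(d ^ n)) : in_An u T ->
  beta1 rho1 T = rtr (avgstate rho1 n *m T).
Proof. by move=> hT; rewrite -(rtr_avgstate_test _ hT). Qed.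

Lemma qsum_converse n (T : 'M[C]_(d ^ n)) s y : in_An u T -> psdmx T ->
  psdmx (1%:M - T) -> 1 < s < 2 -> 0 < y -> beta0 rho0 T < 1 ->
  (1 - beta0 rho0 T) ^+ 2 * y `^ (s - 1) <=
  qsum rho0 rho1 n s * ((1 - beta0 rho0 T) + y * beta1 rho1 T).
Proof.
move=> hT pT pT' s12 y0 b1; rewrite (beta1E hT) -(beta0E hT).
apply: (converse_bound (psdmx_avgstate n p0) (psdmx_avgstate n p1) (avgstate_supp n)
  pT pT' s12 y0).
by rewrite (beta0E hT) subr_gt0.
Qed.

(** The test is the positive part projection of a difference of averaged states; it commutes with
    the group because both states do. *)
Lemma qsum_achieve n (s y : R) : 0 < s < 1 -> 0 < y ->
  exists T : 'M[C]_(d ^ n), [/\ in_An u T, psdmx T, psdmx (1%:M - T) &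
    beta0 rho0 T + y * beta1 rho1 T <= y `^ (1 - s) * qsum rho0 rho1 n s].
Proof.
move=> s01 y0; have q0 := psdmx_avgstate n p0; have q1 := psdmx_avgstate n p1.
have pB := psdmxZ (ltW y0) q1.
have hAB : adj (avgstate rho0 n - y%:C *: avgstate rho1 n) =
    avgstate rho0 n - y%:C *: avgstate rho1 n.
  by rewrite adjB (psdmx_herm q0) (psdmx_herm pB).
pose T := posproj (avgstate rho0 n - y%:C *: avgstate rho1 n).
have pT : psdmx T by apply: fmx_psd => i; case: ifP.
have pT' : psdmx (1%:M - T).
  by rewrite -/(lemx T 1%:M) -(fmx1 (avgstate rho0 n - y%:C *: avgstate rho1 n));
    apply: fmx_le => i; case: ifP.
have hT : in_An u T.
  move=> g; apply: (fmx_intertwine _ hAB hAB).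
  rewrite mulmxBl mulmxBr -scalemxAl -scalemxAr !avgstateE.
  by rewrite !(avg_comm hI (rep_tpow n)).
have := audenaert q0 pB s01; rewrite -/T (mxrpowZ _ q1 y0) -scalemxAr -scalemxAl !rtrZ => h.
exists T; split => //; rewrite (beta1E hT).
have -> : beta0 rho0 T = rtr (avgstate rho0 n *m (1%:M - T)).
  by rewrite mulmxBr mulmx1 rtrB (beta0E hT) rtr_avgstate // opprB addrC subrK.
exact: h.
Qed.

End QSum.
End AveragedStates.

Lemma exists_dominating (R : realType) (d : nat) (rho0 rho1 : 'M[R[i]]_d) :
  density rho0 -> density rho1 ->
  supp_proj rho1 *m supp_proj rho0 = supp_proj rho0 ->
  exists2 c : R, 1 <= c & lemx rho0 (real_complex R c *: rho1).
Proof.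
move=> [p0 t0] [p1 _] hs.
have E1 : mxrpow rho1 0 *m rho0 = rho0.
  by rewrite -{1}(mxrpow_suppl p0) mulmxA hs mxrpow_suppl.
have E2 : rho0 *m mxrpow rho1 0 = rho0.
  have := congr1 (@adj R _ _) E1; rewrite adjM (psdmx_herm p0) adj_mxrpow.
  by [].
have pwV x : 0 <= pw (-1) x :> R by apply: pw_ge0.
(* The sum of the inverse positive eigenvalues bounds each of them, so [c rho_1] is at least the
   support projection of [rho_1], which dominates [rho_0] since [rho_0] has trace one. *)
exists (1 + \sum_i pw (-1) (eig rho1 i)); first by rewrite lerDl sumr_ge0.
apply: (@lemx_trans _ _ (mxrpow rho1 0)).
  have h := le_rtr_scalar p0; rewrite /rtr t0 /= in h.
  have := lemx_conj (mxrpow rho1 0) h.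
  rewrite adj_mxrpow E1 E2 rmorph1 mulmx1 mxrpowD addr0.
  by [].
rewrite -[X in _ *: X](fmx_id (psdmx_herm p1)) fmxZ mxrpowE; apply: fmx_le => i.
have e0 := eig_ge0 i p1.
have h : pw (-1) (eig rho1 i) * eig rho1 i <=
    (1 + \sum_i pw (-1) (eig rho1 i)) * eig rho1 i.
  apply: ler_wpM2r => //; rewrite (bigD1 i) //= addrCA lerDl.
  by apply: addr_ge0; [exact: ler01 | apply: sumr_ge0 => j _; exact: pw_ge0].
apply: le_trans h; rewrite -{3}(pw1 e0) pwM addNr.
by [].
Qed.

(** * Subadditive sequences, convexity and rates *)

Section ScalarAnalysis.
Variable R : realType.
Implicit Types (a : nat -> R) (f : R -> R).

(** The limit is the infimum of [a n / n] over positive [n]; the linear lower bound keeps it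
    finite. *)
Theorem fekete a (K : R) : (forall m n, a (m + n)%N <= a n + a m) ->
  (forall n, - K * n%:R <= a n) -> cvgn (fun n => a n / n%:R).
Proof.
move=> sub lb.
pose S := [set x | exists2 n, (0 < n)%N & x = a n / n%:R].
have lbS : lbound S (- K).
  by move=> _ [n n0 ->]; rewrite ler_pdivlMr ?ltr0n.
have infS : has_inf S by split; [exists (a 1%N / 1); exists 1%N | exists (- K)].
apply/cvg_ex; exists (inf S); apply/cvgrPdist_le => e e0.
have [_ [k k0 ->] hk] := inf_adherent (divr_gt0 e0 (ltr0Sn R 1)) infS.
have iter q r : a (q * k + r)%N <= q%:R * a k + a r.
  elim: q => [|q IH]; first by rewrite mul0n add0n mul0r add0r.
  rewrite mulSn -addnA; apply: (le_trans (sub _ _)).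
  by rewrite -natr1 mulrDl mul1r addrAC lerD2r.
(* For a near-optimal [k], [M] covers the value at the remainder of [n] modulo [k] and the rounding
   of [n / k]. *)
pose M := \sum_(r < k) `|a r| + `|a k|.
have M0 : 0 <= M by rewrite addr_ge0 // sumr_ge0.
have bound n : (0 < n)%N -> a n / n%:R <= a k / k%:R + M / n%:R.
  move=> n0; rewrite ler_pdivrMr ?ltr0n // mulrDl divfK ?pnatr_eq0 -?lt0n //.
  rewrite {1}(divn_eq n k); apply: (le_trans (iter _ _)).
  have rk : (n %% k < k)%N by rewrite ltn_mod.
  have h1 : a (n %% k)%N <= \sum_(r < k) `|a r|.
    apply: (le_trans (ler_norm _)); rewrite (bigD1 (Ordinal rk)) //= lerDl.
    by rewrite sumr_ge0.
  have h2 : (n %/ k)%:R * a k <= a k / k%:R * n%:R + `|a k|.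
    have -> : a k / k%:R * n%:R = (n %/ k)%:R * a k + (n %% k)%:R / k%:R * a k.
      rewrite {1}(divn_eq n k) natrD natrM mulrDr.
      by field; rewrite pnatr_eq0 -lt0n.
    rewrite -addrA lerDl -lerBlDl sub0r; apply: (le_trans (ler_norm _)).
    rewrite normrN normrM ger0_norm ?divr_ge0 // ler_piMl //.
    by rewrite ler_pdivrMr ?ltr0n // mul1r ler_nat ltnW.
  by apply: (le_trans (lerD h2 h1)); rewrite -addrA [`|a k| + _]addrC.
exists (Num.bound (M / (e / 2))).+1 => // n /= hn.
have n0 : (0 < n)%N by apply: leq_trans hn.
have lo : inf S <= a n / n%:R by apply: (ge_inf infS.2); exists n.
rewrite distrC ger0_norm ?subr_ge0 // lerBlDl; apply: (le_trans (bound n n0)).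
have h3 : M / n%:R <= e / 2.
  rewrite ler_pdivrMr ?ltr0n // mulrC -ler_pdivrMr ?divr_gt0 //.
  apply: ltW; apply: (lt_le_trans (archi_boundP _)).
    by rewrite divr_ge0 // divr_ge0 // ltW.
  by rewrite ler_nat ltnW.
by rewrite (splitr e) addrA lerD // ltW.
Qed.

Lemma fekete_super a (K : R) : (forall m n, a n + a m <= a (m + n)%N) ->
  (forall n, a n <= K * n%:R) -> cvgn (fun n => a n / n%:R).
Proof.
move=> sup ub; have : cvgn (fun n => - a n / n%:R).
  apply: (@fekete (fun n => - a n) K) => [m n|n].
    by rewrite -opprD lerN2.
  by rewrite mulNr lerN2.
move=> /cvg_ex[l hl]; apply/cvg_ex; exists (- l).
rewrite (_ : (fun n => a n / n%:R) = (fun n => - (- a n / n%:R))).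
  exact: cvgN hl.
by apply/funext => n; rewrite mulNr opprK.
Qed.

Section ExpSum.
Variables (J : finType) (a b : J -> R).
Hypothesis a0 : forall j, 0 <= a j.
Let f s := \sum_j a j * expR (s * b j).
Variable s0 : R.
Hypothesis f0 : 0 < f s0.

Lemma expsum_gt0 s : 0 < f s.
Proof.
rewrite lt_neqAle eq_sym; apply/andP; split; last first.
  by apply: sumr_ge0 => j _; rewrite mulr_ge0 // expR_ge0.
apply: contraTneq f0 => /eqP h; rewrite -leNgt /f big1 // => j _.
move: h; rewrite psumr_eq0 => [|i _]; last by rewrite mulr_ge0 // expR_ge0.
move/allP/(_ j (mem_index_enum j)) => /=.
by rewrite mulf_eq0 (gt_eqF (expR_gt0 _)) orbF => /eqP ->; rewrite mul0r.
Qed.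

(** Hölder's inequality: after dividing each sum by its value, it is the convexity of [exp] applied
    term by term. *)
Lemma expsum_log_convex s t p : 0 <= p <= 1 ->
  ln (f (p * s + (1 - p) * t)) <= p * ln (f s) + (1 - p) * ln (f t).
Proof.
move=> /andP[p0 p1]; set m := p * ln (f s) + (1 - p) * ln (f t).
have q0 : 0 <= 1 - p by rewrite subr_ge0.
have cvx (x y : R) : expR (p * x + (1 - p) * y) <= p * expR x + (1 - p) * expR y.
  set z := p * x + _.
  have h w : expR z * (1 + (w - z)) <= expR w.
    rewrite -{2}(subrKC z w) [expR (z + _)]expRD ler_wpM2l ?expR_ge0 //.
    exact: expR_ge1Dx.
  have := lerD (ler_wpM2l p0 (h x)) (ler_wpM2l q0 (h y)).
  apply: le_trans; rewrite le_eqVlt; apply/orP; left; apply/eqP.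
  by rewrite /z; ring.
rewrite -ler_expR lnK ?posrE ?expsum_gt0 //.
have : \sum_j a j * expR (p * (s * b j - ln (f s)) + (1 - p) * (t * b j - ln (f t))) <= 1.
  apply: (@le_trans _ _ (\sum_j (p / f s * (a j * expR (s * b j))
      + (1 - p) / f t * (a j * expR (t * b j))))).
    apply: ler_sum => j _; apply: (le_trans (ler_wpM2l (a0 j) (cvx _ _))).
    rewrite !expRD !expRN !lnK ?posrE ?expsum_gt0 // le_eqVlt; apply/orP; left.
    by apply/eqP; field; rewrite !gt_eqF ?expsum_gt0.
  rewrite big_split /= -!mulr_sumr -/(f s) -/(f t) !divfK ?gt_eqF ?expsum_gt0 //.
  by rewrite subrKC.
have -> : f (p * s + (1 - p) * t) = expR m *
    \sum_j a j * expR (p * (s * b j - ln (f s)) + (1 - p) * (t * b j - ln (f t))).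
  rewrite mulr_sumr; apply: eq_bigr => j _; rewrite mulrCA -expRD; congr (_ * expR _).
  by rewrite /m; ring.
by move=> h; rewrite -[leRHS]mulr1 ler_wpM2l // expR_ge0.
Qed.

End ExpSum.

Section Slopes.
Variable f : R -> R.
Hypothesis fcvx : forall s t p, 0 < s < 2 -> 0 < t < 2 -> 0 <= p <= 1 ->
  f (p * s + (1 - p) * t) <= p * f s + (1 - p) * f t.

Let g t := (f (1 + t) - f 1) / t.

(** Three-chord inequality: according to the signs of [t] and [t'], the middle one of [1], [1 + t],
    [1 + t'] is a convex combination of the other two. *)
Lemma slope_mono t t' : -1 < t -> t <= t' -> t' < 1 -> t != 0 -> t' != 0 -> g t <= g t'.
Proof.
move=> t1 tt t'1 t0 t0'; rewrite /g.
have [p|n|e] := ltgtP t 0; last by rewrite e eqxx in t0.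
  have [p'|n'|e'] := ltgtP t' 0; last by rewrite e' eqxx in t0'.
    have h1 : 0 <= t' / t <= 1.
      rewrite -mulrNN -invrN; apply/andP; split; first by rewrite divr_ge0 //; lra.
      by rewrite ler_pdivrMr; lra.
    have := @fcvx (1 + t) 1 (t' / t) _ _ h1.
    have -> : t' / t * (1 + t) + (1 - t' / t) * 1 = 1 + t' by field.
    move=> /(_ ltac:(lra) ltac:(lra)) h2.
    rewrite ler_ndivlMr // mulrAC -mulrA; move: h2.
    by move: (t' / t) (f (1 + t)) (f (1 + t')) => q x y; lra.
  have tt' : 0 < t' - t by lra.
  have h1 : 0 <= t' / (t' - t) <= 1.
    apply/andP; split; first by apply: divr_ge0; exact: ltW.
    by rewrite ler_pdivrMr // mul1r; lra.
  have := @fcvx (1 + t) (1 + t') (t' / (t' - t)) _ _ h1.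
  have -> : t' / (t' - t) * (1 + t) + (1 - t' / (t' - t)) * (1 + t') = 1.
    by field; rewrite gt_eqF.
  move=> /(_ ltac:(lra) ltac:(lra)) h2.
  rewrite ler_pdivlMr // mulrAC ler_ndivrMr //.
  have : (t' - t) * f 1 <= t' * f (1 + t) - t * f (1 + t').
    have := ler_wpM2l (ltW tt') h2; set X := f (1 + t); set Y := f (1 + t').
    have -> : (t' - t) * (t' / (t' - t) * X + (1 - t' / (t' - t)) * Y) = t' * X - t * Y.
      by field; rewrite gt_eqF.
    by [].
  lra.
have t'0 : 0 < t' by apply: lt_le_trans tt.
have h1 : 0 <= t / t' <= 1.
  apply/andP; split; first by apply: divr_ge0; exact: ltW.
  by rewrite ler_pdivrMr // mul1r.
have := @fcvx (1 + t') 1 (t / t') _ _ h1.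
have -> : t / t' * (1 + t') + (1 - t / t') * 1 = 1 + t by field.
move=> /(_ ltac:(lra) ltac:(lra)) h2.
rewrite ler_pdivrMr // mulrAC -mulrA; move: h2.
by move: (t / t') (f (1 + t)) (f (1 + t')) => q x y; lra.
Qed.

(** A slope from the opposite side of [1] bounds the monotone quotients, so the one-sided limits are
    finite. *)
Let slope_gap_left y : 0 < y -> y < 1 -> g (- 2^-1) <= g y.
Proof.
move=> y0 y1; apply: slope_mono; [by lra | by lra | by [] | | by rewrite gt_eqF].
by rewrite lt_eqF // oppr_lt0 invr_gt0.
Qed.

Let slope_gap_right y : -1 < y -> y < 0 -> g y <= g 2^-1.
Proof.
move=> y0 y1; apply: slope_mono; [by [] | by lra | by lra | by rewrite lt_eqF |].
by rewrite gt_eqF // invr_gt0.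
Qed.

Lemma right_slope_cvg : cvg (g t @[t --> 0^'+]).
Proof.
apply: nondecreasing_at_right_is_cvgr; near=> x.
  have x1 : x <= 1 by near: x; apply: nbhs_right_le; apply: ltr01.
  move=> y z; rewrite !in_itv /= => /andP[y0 yx] /andP[z0 zx] yz.
  by apply: slope_mono => //; rewrite ?gt_eqF //; lra.
have x1 : x <= 1 by near: x; apply: nbhs_right_le; apply: ltr01.
exists (g (- 2^-1)) => _ [y /= + <-]; rewrite in_itv /= => /andP[y0 yx].
have y1 : y < 1 := lt_le_trans yx x1.
exact: slope_gap_left.
Unshelve. all: by end_near. Qed.

Lemma left_slope_cvg : cvg (g t @[t --> 0^'-]).
Proof.
have h1 : -1 < 0 :> R by lra.
apply: nondecreasing_at_left_is_cvgr; near=> x.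
  have x1 : -1 <= x by near: x; apply: nbhs_left_ge.
  move=> y z; rewrite !in_itv /= => /andP[y0 yx] /andP[z0 zx] yz.
  by apply: slope_mono => //; rewrite ?lt_eqF //; lra.
have x1 : -1 <= x by near: x; apply: nbhs_left_ge.
exists (g (2^-1)) => _ [y /= + <-]; rewrite in_itv /= => /andP[y0 yx].
have y1 : -1 < y := le_lt_trans x1 y0.
exact: slope_gap_right.
Unshelve. all: by end_near. Qed.

End Slopes.

(** Rate bounds come at a fixed exponent and with a strict gap; an arbitrary slack [e] covers both
    the gap and the passage to the derivative. *)
Lemma right_cvg_ereal_ge (g : R -> R) (x : \bar R) :
  cvg (g t @[t --> 0^'+]) ->
  (forall t l, 0 < t < 1 -> l < - g t -> (l%:E <= x)%E) ->
  ((- lim (g t @[t --> 0^'+]))%:E <= x)%E.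
Proof.
move=> cg h; set L := lim _ in cg *; apply/lee_subgt0Pr => e e0.
have gL : g t @[t --> 0^'+] --> L by exact: cg.
have /cvgrPdist_lt/(_ e e0) hn := gL.
have : \forall t \near 0^'+, 0 < t < 1 /\ `|L - g t| < e.
  near=> t; split; last by near: t; exact: hn.
  apply/andP; split; near: t; first exact: nbhs_right_gt.
  by apply: nbhs_right_lt; apply: ltr01.
move=> /filter_ex[t [t01 ht]]; rewrite -EFinB; apply: (h t) => //.
by move: ht; rewrite ltr_norml; lra.
Unshelve. all: by end_near. Qed.

Lemma left_cvg_ereal_le (g : R -> R) (x : \bar R) :
  cvg (g t @[t --> 0^'-]) ->
  (forall t l, -1 < t < 0 -> l < g t -> (x <= (- l)%:E)%E) ->
  (x <= (- lim (g t @[t --> 0^'-]))%:E)%E.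
Proof.
move=> cg h; set L := lim _ in cg *; apply/lee_addgt0Pr => e e0.
have h1 : -1 < 0 :> R by lra.
have gL : g t @[t --> 0^'-] --> L by exact: cg.
have /cvgrPdist_lt/(_ e e0) hn := gL.
have : \forall t \near 0^'-, -1 < t < 0 /\ `|L - g t| < e.
  near=> t; split; last by near: t; exact: hn.
  apply/andP; split; near: t; last exact: nbhs_left_lt.
  exact: nbhs_left_gt.
move=> /filter_ex[t [t01 ht]]; rewrite -EFinD.
have -> : - L + e = - (L - e) by rewrite opprB addrC.
apply: (h t) => //.
by move: ht; rewrite ltr_norml; lra.
Unshelve. all: by end_near. Qed.

Lemma limn_esup_le_near (v : nat -> \bar R) (l : \bar R) :
  (\forall n \near \oo, (v n <= l)%E) -> (limn_esup v <= l)%E.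
Proof.
move=> h; rewrite /limn_esup /limf_esup.
apply: (@le_trans _ _ (ereal_sup (v @` [set n | (v n <= l)%E]))).
  by apply: ereal_inf_lbound; exists [set n | (v n <= l)%E].
by apply: ge_ereal_sup => _ [n /= hn <-].
Qed.

Lemma limn_einf_ge_near (v : nat -> \bar R) (l : \bar R) :
  (\forall n \near \oo, (l <= v n)%E) -> (l <= limn_einf v)%E.
Proof.
move=> h; rewrite -[l]oppeK /limn_einf leeN2.
by apply: limn_esup_le_near; apply: filterS h => n; rewrite leeN2.
Qed.

End ScalarAnalysis.

Lemma near_div_small (R : realType) (k e : R) : 0 < e ->
  \forall n \near \oo, k / n%:R <= e.
Proof.
move=> e0; exists (Num.bound (`|k| / e)).+1 => // n /= hn.
have n0 : (0 < n)%N by apply: leq_trans hn.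
rewrite ler_pdivrMr ?ltr0n // mulrC -ler_pdivrMr //.
apply: (@le_trans _ _ (`|k| / e)); first by rewrite ler_wpM2r ?invr_ge0 ?ler_norm ?ltW.
apply: ltW; apply: (lt_le_trans (archi_boundP _)); first by rewrite divr_ge0 // ltW.
by rewrite ler_nat ltnW.
Qed.

(** * Convergence and convexity of [psi], and the two rate bounds *)

Section Rates.
Variables (R : realType) (G : topologicalType) (mul : G -> G -> G)
  (inv : G -> G) (one : G) (I : (G -> R) -> R).
Hypotheses (hG : is_compact_group mul inv one) (hI : is_haar_integral mul I).
Variables (d : nat) (u : G -> 'M[R[i]]_d).
Hypothesis hu : is_unitary_rep mul u.
Variables (rho0 rho1 : 'M[R[i]]_d) (c : R).
Hypotheses (h0 : density rho0) (h1 : density rho1) (c1 : 1 <= c)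
  (hc : lemx rho0 (real_complex R c *: rho1)).

Local Notation Q := (qsum I u rho0 rho1).
Local Notation psiG := (psi I u rho0 rho1).

Let c0 : 0 < c. Proof. exact: lt_le_trans ltr01 c1. Qed.

Lemma qsum_gt0 n s : 0 < Q n s.
Proof.
have [a [b [a0 E]]] := qsum_expR I u rho0 rho1 n; rewrite E.
by apply: (@expsum_gt0 _ _ _ _ a0 1); rewrite -E (qsum1 hI hu h0 h1 hc).
Qed.

Lemma psi_n_cvx n s t p : 0 <= p <= 1 ->
  psi_n I u rho0 rho1 n (p * s + (1 - p) * t) <=
  p * psi_n I u rho0 rho1 n s + (1 - p) * psi_n I u rho0 rho1 n t.
Proof.
move=> p01; have [a [b [a0 E]]] := qsum_expR I u rho0 rho1 n.
have f1 : 0 < \sum_j a j * expR (1 * b j) by rewrite -E qsum_gt0.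
by have := expsum_log_convex a0 f1 s t p01; rewrite -!E.
Qed.

Lemma psi_n1 n : psi_n I u rho0 rho1 n 1 = 0.
Proof.
have E : psi_n I u rho0 rho1 n 1 = ln (Q n 1) by [].
by rewrite E (qsum1 hI hu h0 h1 hc) ln1.
Qed.

Lemma psi_n_cvg s : 0 < s < 2 -> cvgn (fun n => psi_n I u rho0 rho1 n s / n%:R).
Proof.
move=> /andP[s0 s2].
have lnX n : ln (c ^+ n) = ln c * n%:R by rewrite lnXn // mulr_natr.
have [s1|s1|->] := ltgtP s 1.
- have s01 : 0 < s < 1 by rewrite s0.
  apply: (@fekete _ (fun n => ln (Q n s)) ((1 - s) * ln c)) => [m n|n].
    rewrite -lnM ?posrE ?qsum_gt0 // ler_ln ?posrE ?mulr_gt0 ?qsum_gt0 //.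
    exact: (qsum_sub hG hI hu h0 h1).
  have := qsum_ge hI hu h0 h1 c0 hc n s01.
  rewrite -ler_ln ?posrE ?mulr_gt0 ?powR_gt0 ?exprn_gt0 ?qsum_gt0 //.
  rewrite ln1 lnM ?posrE ?powR_gt0 ?exprn_gt0 ?qsum_gt0 // ln_powR lnX.
  by rewrite mulNr -mulrA -lerBlDl sub0r.
- have s12 : 1 < s < 2 by rewrite s1.
  apply: (@fekete_super _ (fun n => ln (Q n s)) ((s - 1) * ln c)) => [m n|n].
    rewrite -lnM ?posrE ?qsum_gt0 // ler_ln ?posrE ?mulr_gt0 ?qsum_gt0 //.
    exact: (qsum_super hG hI hu h0 h1 hc).
  have := qsum_le hI hu h0 h1 c0 hc n s12.
  rewrite -ler_ln ?posrE ?powR_gt0 ?exprn_gt0 ?qsum_gt0 // ln_powR lnX.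
  by rewrite mulrA.
- apply/cvg_ex; exists 0; under eq_fun do rewrite psi_n1 mul0r.
  exact: cvg_cst.
Qed.

Lemma psi1 : psiG 1 = 0.
Proof.
rewrite /psi; under eq_fun do rewrite psi_n1 mul0r.
exact: lim_cst.
Qed.

Lemma psi_cvx s t p : 0 < s < 2 -> 0 < t < 2 -> 0 <= p <= 1 ->
  psiG (p * s + (1 - p) * t) <= p * psiG s + (1 - p) * psiG t.
Proof.
move=> hs ht p01; have /andP[p0 p1] := p01.
have pos x y : 0 < x -> 0 < y -> 0 < p * x + (1 - p) * y.
  move=> x0 y0; have [->|pn] := eqVneq p 0.
    by rewrite mul0r add0r subr0 mul1r.
  apply: ltr_pwDl; first by rewrite mulr_gt0 // lt_neqAle eq_sym pn.
  by rewrite mulr_ge0 ?subr_ge0 // ltW.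
have hm : 0 < p * s + (1 - p) * t < 2.
  have /andP[s0 s2] := hs; have /andP[t0 t2] := ht.
  rewrite pos //= -subr_gt0; have -> : 2 - (p * s + (1 - p) * t) =
    p * (2 - s) + (1 - p) * (2 - t) by ring.
  by apply: pos; rewrite subr_gt0.
have cR : (fun n => p * (psi_n I u rho0 rho1 n s / n%:R)
    + (1 - p) * (psi_n I u rho0 rho1 n t / n%:R)) @ \oo -->
    p * psiG s + (1 - p) * psiG t.
  apply: cvgD; (apply: cvgM; first exact: cvg_cst).
    exact: (psi_n_cvg hs).
  exact: (psi_n_cvg ht).
apply: (ler_cvg_to (psi_n_cvg hm) cR); apply: nearW => n.
rewrite !mulrA -mulrDl ler_wpM2r ?invr_ge0 //.
exact: psi_n_cvx.
Qed.

Variable eps : R.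
Hypothesis heps : 0 < eps < 1.

Lemma beta1_ge n (T : 'M[R[i]]_(d ^ n)) s : in_An u T -> psdmx T -> psdmx (1%:M - T) ->
  beta0 rho0 T <= eps -> 1 < s < 2 ->
  0 < beta1 rho1 T /\
  ln (1 - eps) - (ln (2 / (1 - eps)) + psi_n I u rho0 rho1 n s) / (s - 1) <=
  ln (beta1 rho1 T).
Proof.
move=> hT pT pT' hb s12; have /andP[e0 e1] := heps.
set k := 1 - eps; have k0 : 0 < k by rewrite subr_gt0.
set t := s - 1; have t0 : 0 < t by case/andP: s12 => *; rewrite subr_gt0.
have Q0 := qsum_gt0 n s; set q := beta1 rho1 T.
have kQ : 0 < 2 / k * Q n s by rewrite mulr_gt0 // divr_gt0.
(* Chosen so that [y^t = 2 Q / k]: the converse inequality becomes [2 p^2 / k <= p + y q], and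
   [p >= k] leaves [k <= p <= y q], so [q] is also positive. *)
pose y := expR (ln (2 / k * Q n s) / t).
have y0 : 0 < y by apply: expR_gt0.
have yt : y `^ t = 2 / k * Q n s.
  by rewrite powRE // expRK mulrC divfK ?gt_eqF // lnK.
have b1 : beta0 rho0 T < 1 by apply: le_lt_trans hb e1.
have := qsum_converse hI hu h0 h1 hc hT pT pT' s12 y0 b1.
rewrite -/t yt -/q; set p := 1 - beta0 rho0 T => h.
have kp : k <= p by rewrite lerD2l lerN2.
have {}h : 2 / k * p ^+ 2 <= p + y * q.
  by move: h; rewrite mulrA [_ * Q n s]mulrC ler_pM2l // mulrC.
have h2 : 2 * p <= 2 / k * p ^+ 2.
  rewrite -mulrA ler_pM2l // mulrC ler_pdivlMr // expr2 ler_wpM2l //.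
  exact: ltW (lt_le_trans k0 kp).
have h3 : k / y <= q by rewrite ler_pdivrMr // mulrC; lra.
have q0 : 0 < q by apply: lt_le_trans h3; rewrite divr_gt0.
split => //; have : ln (k / y) <= ln q by rewrite ler_ln ?posrE ?divr_gt0.
apply: le_trans; rewrite [ln (k / y)]lnM ?posrE ?invr_gt0 // lnV ?posrE // /y expRK.
by rewrite [ln (2 / k * Q n s)]lnM ?posrE ?divr_gt0.
Qed.

Lemma converse_rate T t l : admissible u rho0 eps T -> 0 < t < 1 ->
  l < - ((psiG (1 + t) - psiG 1) / t) ->
  (l%:E <= limn_einf (fun n => lograte n (beta1 rho1 (T n))))%E.
Proof.
move=> hT /andP[t0 t1]; rewrite psi1 subr0 => hl; set s := 1 + t in hl *.
have s12 : 1 < s < 2 by rewrite /s; lra.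
have ts : s - 1 = t by rewrite /s; lra.
have s02 : 0 < s < 2 by rewrite /s; lra.
set k := ln (2 / (1 - eps)) / t - ln (1 - eps).
pose e := - (psiG s / t) - l; have e0 : 0 < e by rewrite subr_gt0.
(* Half of the gap [e] pays for the convergence of [psi_n / n], scaled by [t] since it is divided by
   [t] later; the other half pays for the constant [k]. *)
have et : 0 < e / 2 * t by rewrite mulr_gt0 // divr_gt0.
have hF : \forall n \near \oo, psi_n I u rho0 rho1 n s / n%:R < psiG s + e / 2 * t.
  by apply: (cvgr_lt _ (psi_n_cvg s02)); rewrite ltrDl.
apply: limn_einf_ge_near; near=> n.
have [a1 a2 a3 a4] := hT n.
have [q0 hq] := beta1_ge a1 a2 a3 a4 s12; rewrite ts in hq.
rewrite /lograte (lt_geF q0) lee_fin.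
have n0 : 0 < n%:R :> R by rewrite ltr0n; near: n; exact: nbhs_infty_gt.
have f1 : psi_n I u rho0 rho1 n s / n%:R < psiG s + e / 2 * t by near: n; exact: hF.
have f2 : k / n%:R <= e / 2 by near: n; apply: near_div_small; rewrite divr_gt0.
apply: (@le_trans _ _ ((- k - psi_n I u rho0 rho1 n s / t) / n%:R)); last first.
  apply: ler_wpM2r; first by rewrite invr_ge0 ltW.
  by apply: le_trans hq; rewrite /k mulrDl; lra.
have {}f1 : psi_n I u rho0 rho1 n s / n%:R / t <= psiG s / t + e / 2.
  by rewrite ler_pdivrMr // mulrDl divfK ?gt_eqF // ltW.
rewrite mulrDl mulNr mulNr mulrAC.
rewrite (_ : l = - (psiG s / t) - e); last by rewrite /e; lra.
by lra.
Unshelve. all: by end_near. Qed.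

Lemma test_exists n s y : 0 < s < 1 -> 0 < y -> exists T : 'M[R[i]]_(d ^ n),
  [/\ in_An u T, psdmx T, psdmx (1%:M - T) & beta0 rho0 T <= eps] /\
  (y `^ (1 - s) * Q n s <= eps -> y * beta1 rho1 T <= 1).
Proof.
move=> s01 y0; have /andP[e0 e1] := heps.
have [p0 _] := h0; have [p1 _] := h1.
have [hB|hB] := leP (y `^ (1 - s) * Q n s) eps; last first.
  (* Admissibility is required for every [n], the rate only eventually; until the bound drops below
     [eps] the trivial test, with zero first error, fills in. *)
  exists 1%:M; split => //.
  have p1' : psdmx (1%:M - 1%:M : 'M[R[i]]_(d ^ n)) by apply: lemx_refl.
  split => //; [by move=> g; rewrite mulmx1 mul1mx | exact: psdmx1 |].
  by rewrite /beta0 subrr mulmx0 linear0 ltW.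
have [T [a1 a2 a3 a4]] := qsum_achieve hI hu h0 h1 n s01 y0.
have b0 : 0 <= beta0 rho0 T by apply: rtr_mul_ge0 a3; apply: tpow_psd.
have b1 : 0 <= beta1 rho1 T by apply: rtr_mul_ge0 a2; apply: tpow_psd.
have yb : 0 <= y * beta1 rho1 T by rewrite mulr_ge0 // ltW.
exists T; split; last by move=> _; lra.
by split => //; lra.
Qed.

Lemma achieve_rate t l : -1 < t < 0 -> l < (psiG (1 + t) - psiG 1) / t ->
  (s_upper u rho0 rho1 eps <= (- l)%:E)%E.
Proof.
move=> /andP[t1 t0]; rewrite psi1 subr0 => hl; set s := 1 + t in hl *.
have /andP[e0 e1] := heps.
have s01 : 0 < s < 1 by rewrite /s; lra.
have s02 : 0 < s < 2 by rewrite /s; lra.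
have ts : 1 - s = - t by rewrite /s; lra.
have hl' : psiG s < l * t by move: hl; rewrite ltr_ndivlMr.
(* With [y = exp(n l)], the logarithm of the bound is about [n (psi(s) - l t) = - 2 e n]; one [e] is
   spent on the convergence of [psi_n / n], the other on reaching [ln eps]. *)
pose e := (l * t - psiG s) / 2; have e2 : 0 < e by rewrite divr_gt0 // subr_gt0.
have E n := cid (@test_exists n s (expR (n%:R * l)) s01 (expR_gt0 _)).
pose T n := sval (E n).
have hT : admissible u rho0 eps T by move=> n; have [] := svalP (E n).
apply: (@le_trans _ _ (limn_esup (fun n => lograte n (beta1 rho1 (T n))))).
  by apply: ereal_inf_lbound; exists T.
have hF : \forall n \near \oo, psi_n I u rho0 rho1 n s / n%:R < psiG s + e.
  by apply: (cvgr_lt _ (psi_n_cvg s02)); rewrite ltrDl.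
apply: limn_esup_le_near; near=> n.
have n0 : 0 < n%:R :> R by rewrite ltr0n; near: n; exact: nbhs_infty_gt.
have f1 : psi_n I u rho0 rho1 n s / n%:R < psiG s + e by near: n; exact: hF.
have f2 : - ln eps / n%:R <= e by near: n; exact: near_div_small.
have [_ hb] := svalP (E n); rewrite -/(T n) in hb.
have {}hb : expR (n%:R * l) * beta1 rho1 (T n) <= 1.
  apply: hb; rewrite -ler_ln ?posrE ?mulr_gt0 ?powR_gt0 ?expR_gt0 ?qsum_gt0 //.
  rewrite lnM ?posrE ?powR_gt0 ?expR_gt0 ?qsum_gt0 // ln_powR expRK ts.
  have E1 : ln (Q n s) = psi_n I u rho0 rho1 n s by [].
  rewrite E1; move: f1 f2; rewrite ltr_pdivrMr // ler_pdivrMr // => f1 f2.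
  have : (psiG s + e) * n%:R - t * (n%:R * l) = - (e * n%:R) by rewrite /e; lra.
  by lra.
rewrite /lograte; case: (leP (beta1 rho1 (T n)) 0) => b0; first exact: leNye.
rewrite lee_fin ler_pdivrMr //.
have : ln (expR (n%:R * l) * beta1 rho1 (T n)) <= ln 1.
  by rewrite ler_ln ?posrE ?mulr_gt0 ?expR_gt0.
by rewrite lnM ?posrE ?expR_gt0 // expRK ln1; lra.
Unshelve. all: by end_near. Qed.

End Rates.

Theorem theorem4p5 (R : realType) (G : topologicalType)
  (mul : G -> G -> G) (inv : G -> G) (one : G)
  (hG : is_compact_group mul inv one)
  (I : (G -> R) -> R) (hI : is_haar_integral mul I)
  (d : nat) (u : G -> 'M[R[i]]_d) (hu : is_unitary_rep mul u)
  (rho0 rho1 : 'M[R[i]]_d) (h0 : density rho0) (h1 : density rho1)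
  (hsupp1 : forall g, supp_proj rho1 *m u g = u g *m supp_proj rho1)
  (hsupp01 : supp_proj rho1 *m supp_proj rho0 = supp_proj rho0)
  (eps : R) (heps : 0 < eps < 1) :
  let psiG := psi I u rho0 rho1 in
  ((- right_deriv psiG 1)%:E <= s_lower u rho0 rho1 eps)%E /\
  (s_lower u rho0 rho1 eps <= s_upper u rho0 rho1 eps)%E /\
  (s_upper u rho0 rho1 eps <= (- left_deriv psiG 1)%:E)%E.
Proof.
move=> psiG; have [c c1 hc] := exists_dominating h0 h1 hsupp01.
have cvx := psi_cvx hG hI hu h0 h1 c1 hc.
split; [|split].
- apply: right_cvg_ereal_ge; first exact: right_slope_cvg cvx.
  move=> t l t01 hl; apply/ereal_infP => _ [T hT <-].
  exact: (converse_rate hG hI hu h0 h1 c1 hc heps hT t01 hl).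
- apply/ereal_infP => _ [T hT <-].
  apply: le_trans (limn_einf_sup _).
  by apply: ereal_inf_lbound; exists T.
- apply: left_cvg_ereal_le; first exact: left_slope_cvg cvx.
  move=> t l t01 hl.
  exact: (achieve_rate hG hI hu h0 h1 c1 hc heps t01 hl).
Qed.
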